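(* Let $X$ be an infinite discrete abelian group with Haar measure $\alpha$ and let $\hat X$ be its (compact) dual group with Haar measure $\hat\alpha$, normalized as in the context. For $0<p,q\le\infty$ let $C_{p,q}$ be the $(p,q)$-norm of the Fourier operator defined in the context. Consider the regions $$R_1'=\Big\{\Big(\tfrac1p,\tfrac1q\Big)\in[0,\infty)^2:\ \tfrac1p+\tfrac1q<1,\ \tfrac1q<\tfrac12\Big\},$$ $$R_2'=\Big\{\Big(\tfrac1p,\tfrac1q\Big)\in[0,\infty)^2:\ \tfrac1p+\tfrac1q\ge 1,\ \tfrac1p\ge\tfrac12\Big\},$$ $$R_3'=\Big\{\Big(\tfrac1p,\tfrac1q\Big)\in[0,1]^2:\ \tfrac1p<\tfrac12,\ \tfrac1q\ge\tfrac12\Big\}.$$ Then $$C_{p,q}=\begin{cases}\infty & \text{if } (1/p,1/q)\in R_1'\cup R_3',\\ \hat\alpha(\hat X)^{1/p+1/q-1} & \text{if } (1/p,1/q)\in R_2'.\end{cases}$$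
   Context: For a locally compact abelian group $X$ with Haar measure $\alpha$, $\hat X$ denotes the group of continuous homomorphisms $\gamma:X\to\mathbb T$ under pointwise multiplication, and the Fourier transform of $f\in L^1(X)$ is $\hat f(\gamma)=\int_X f(x)\overline{\gamma(x)}\,\alpha(dx)$, extended to $L^2(X)$ by the Plancherel theorem. When $X$ is discrete, $\alpha$ gives the same mass $c>0$ to every point, $\hat X$ is compact, and $\hat\alpha$ is the Haar measure on $\hat X$ with total mass $\hat\alpha(\hat X)=1/c$ (the normalization for which Fourier inversion and $\|f\|_2=\|\hat f\|_2$ hold). For $0<p<\infty$, $\|f\|_p=(\int|f|^p)^{1/p}$ (a quasi-norm if $p<1$), $\|f\|_\infty$ is the essential supremum, and $1/\infty=0$. For discrete $X$, $C_{p,q}:=\sup\{\|\hat f\|_{L^q(\hat X,\hat\alpha)}: f\in L^2(X)\cap L^p(X),\ \|f\|_{L^p(X,\alpha)}=1\}$ (note $L^2\cap L^p=L^p$ if $p\le 2$ and $=L^2$ if $p>2$). *)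

(* Defs.v *)
From HB Require Import structures.
From mathcomp Require Import all_boot all_order all_algebra.
From mathcomp Require Import all_classical all_reals all_analysis.
From mathcomp Require Import finmap complex.

Set Implicit Arguments.
Unset Strict Implicit.
Unset Printing Implicit Defensive.

Import Order.TTheory GRing.Theory Num.Theory.
Local Open Scope classical_set_scope.
Local Open Scope ring_scope.

Definition discr (X : zmodType) : Type := X.

Section discr_instances.
Variable X : zmodType.
HB.instance Definition _ := Choice.on (discr X).
HB.instance Definition _ := isPointed.Build (discr X) (0 : X).
HB.instance Definition _ := @isMeasurable.Build default_measure_display
  (discr X) discrete_measurable discrete_measurable0
  discrete_measurableC discrete_measurableU.
End discr_instances.

Definition haar_discr (R : realType) (X : zmodType) (c : {posnum R})
  : {measure set (discr X) -> \bar R} :=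
  mscale (c%:num)%:nng (@counting (discr X) R).

(* The dual group: continuous (= all, X being discrete) homomorphisms X -> T. *)
Definition is_character (R : realType) (X : zmodType) (g : X -> R[i]) :=
  (forall x y, g (x + y) = g x * g y) /\ (forall x, Normc.normc (g x) = 1).

Record character (R : realType) (X : zmodType) := Character {
  chr :> X -> R[i];
  chr_is_character : is_character chr }.

Section character_instances.
Variables (R : realType) (X : zmodType).

Lemma trivial_character : is_character (fun _ : X => (1 : R[i])).
Proof.
split => [x y|x]; first by rewrite mulr1.
by rewrite Normc.normc1.
Qed.

HB.instance Definition _ := gen_eqMixin (character R X).
HB.instance Definition _ := gen_choiceMixin (character R X).
HB.instance Definition _ :=
  isPointed.Build (character R X) (Character trivial_character).
End character_instances.

(* The sigma-algebra on the dual generated by the evaluation maps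
   gamma |-> complex.Re (gamma x), gamma |-> complex.Im (gamma x), x in X
   (the Baire sigma-algebra of the compact dual group). *)
Definition eval_sets (R : realType) (X : zmodType) : set (set (character R X)) :=
  [set A | exists x : X, exists B : set R, measurable B /\
     (A = (fun g : character R X => complex.Re (g x)) @^-1` B \/
      A = (fun g : character R X => complex.Im (g x)) @^-1` B)].

Definition dual (R : realType) (X : zmodType) :=
  g_sigma_algebraType (@eval_sets R X).

Definition dual_haar (R : realType) (X : zmodType) (c : {posnum R})
  (mu : {measure set (dual R X) -> \bar R}) : Prop :=
  mu [set: dual R X] = (c%:num^-1)%:E /\
  forall (eta : dual R X) (A : set (dual R X)), measurable A ->
    mu [set g : dual R X | exists2 g' : dual R X, A g' &
                           forall x, chr g x = chr eta x * chr g' x] = mu A.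

(* Fourier transform.  For a finite F, the transform of f restricted to F is
   c * sum_{x in F} f x * conj(gamma x).  The Fourier (Plancherel) transform
   of f in L^2(X) is the L^2(\hat X)-limit of these along finite sets F.      *)
Definition partial_fourier (R : realType) (X : zmodType) (c : {posnum R})
  (f : X -> R[i]) (F : {fset X}) (g : dual R X) : R[i] :=
  ((c%:num)%:C)%C * \sum_(x <- F) f x * conjc (chr g x).

Definition is_fourier (R : realType) (X : zmodType) (c : {posnum R})
  (mu : {measure set (dual R X) -> \bar R}) (f : X -> R[i]) (fh : dual R X -> R[i]) :=
  measurable_fun [set: dual R X] (fun g => complex.Re (fh g)) /\
  measurable_fun [set: dual R X] (fun g => complex.Im (fh g)) /\
  forall e : R, 0 < e -> exists F0 : {fset X}, forall F : {fset X},
    (F0 `<=` F)%fset ->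
    (Lnorm mu 2%:E (fun g => (Normc.normc (fh g - partial_fourier c f F g))%:E)
      < e%:E)%E.

Definition normX (R : realType) (X : zmodType) (c : {posnum R}) (p : \bar R)
  (f : X -> R[i]) : \bar R :=
  Lnorm (haar_discr X c) p (fun x : discr X => (Normc.normc (f x))%:E).

Definition Cpq (R : realType) (X : zmodType) (c : {posnum R})
  (mu : {measure set (dual R X) -> \bar R}) (p q : \bar R) : \bar R :=
  ereal_sup [set y | exists (f : X -> R[i]) (fh : dual R X -> R[i]),
    [/\ (normX c 2%:E f < +oo)%E, normX c p f = 1%E, is_fourier c mu f fh &
        y = Lnorm mu q (fun g => (Normc.normc (fh g))%:E)]].

Definition recip (R : realType) (p : \bar R) : R :=
  match p with r%:E => r^-1 | _ => 0 end.

(* Main.v *)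
(** Upper bound on [R2'].  For [1 < p <= 2] it is the Hausdorff-Young inequality
with constant one, for which we follow F. Riesz.  For finite sums [Sf] of an
orthonormal system bounded by one, let [M r] be the maximum of the mean of
[|Sf| ^ r] over the unit ball of l^p, [p = r / (r - 1)].  The Lagrange equation
of a maximizer combined with Bessel's inequality gives
[M r ^ 2 <= M (2 r - 2)]; since [M] is at most the number of terms for every
exponent, iterating gives [M r <= 1].  For [p <= 1] the transform is bounded
pointwise.  Truncation passes these bounds to the L^2-limit, and Hoelder's
inequality on the finite dual measure lowers the exponent to [q].  Equality
holds for a point mass.

Infinite constant on [R1'].  [X] contains arbitrarily large finite sets [F]
with [|F - F| <= 2 |F|].  The transform of the indicator function of [F] then
has fourth moment at least [|F| ^ 3 / 2], so it has size comparable to [|F|] on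
a set of measure comparable to [1 / |F|], and the ratio of the norms grows like
[|F| ^ (1 - 1/p - 1/q)].

Infinite constant on [R3'].  For suitable signs on [F] the transform has second
moment [|F|] and fourth moment at most [3 |F| ^ 2], hence all its moments of
order [q <= 2] are comparable to [|F| ^ (q / 2)], and the ratio of the norms
grows like [|F| ^ (1/2 - 1/p)].

Orthogonality of the characters uses only the invariance of the dual measure
and the existence of a character that is not one at a given non-zero point
(Zorn's lemma). *)
Require Import Defs.
From HB Require Import structures.
From mathcomp Require Import all_boot all_order all_algebra.
From mathcomp Require Import all_classical all_reals all_analysis.
From mathcomp Require Import measurable_realfun ess_sup_inf.
From mathcomp Require Import finmap complex ring lra.
Import Order.TTheory GRing.Theory Num.Theory.
Import numFieldNormedType.Exports.
Import Normc.
Set Implicit Arguments.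
Unset Strict Implicit.
Unset Printing Implicit Defensive.
Local Open Scope classical_set_scope.
Local Open Scope ring_scope.

(** * Bounded measurable functions and their means *)

Section complex_norm.
Context {R : realType}.
Implicit Types (z w : R[i]) (a b : R).

Lemma normc_ge0 z : 0 <= normc z.
Proof. by case: z => a b; rewrite sqrtr_ge0. Qed.

Lemma sqr_normcE z : normc z ^+ 2 = complex.Re z ^+ 2 + complex.Im z ^+ 2.
Proof. by case: z => a b /=; rewrite sqr_sqrtr// addr_ge0 ?sqr_ge0. Qed.

Lemma normc_conj z : normc (conjc z) = normc z.
Proof. by case: z => a b /=; rewrite sqrrN. Qed.

Lemma normc_real a : normc (a%:C)%C = `|a|.
Proof. by rewrite /= expr0n addr0 sqrtr_sqr. Qed.

Lemma Re_le_normc z : complex.Re z <= normc z.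
Proof.
case: z => a b /=; rewrite (le_trans (ler_norm a))// -sqrtr_sqr.
by rewrite ler_wsqrtr// lerDl sqr_ge0.
Qed.

Lemma normc_le_add z : normc z <= `|complex.Re z| + `|complex.Im z|.
Proof.
rewrite -(@ler_pXn2r _ 2)// ?nnegrE ?normc_ge0 ?addr_ge0//.
rewrite sqr_normcE sqrrD !real_normK ?num_real// -addrA lerD2l lerDr.
by rewrite mulrn_wge0// mulr_ge0.
Qed.

Lemma ler_dist_normc z w : `|normc z - normc w| <= normc (z - w).
Proof.
rewrite ler_distl lerBlDr; apply/andP; split.
  by rewrite -(normcN (z - w)) opprB (le_trans _ (le_normcD _ _))// subrKC.
by rewrite (le_trans _ (le_normcD _ _))// addrC subrK.
Qed.

Lemma mul_conjc z : z * conjc z = ((normc z ^+ 2)%:C)%C.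
Proof.
case: z => a b; rewrite sqr_normcE /=.
by apply/eqP; rewrite eq_complex /=; apply/andP; split; apply/eqP; ring.
Qed.

Lemma normc_sum (I : Type) (s : seq I) (F : I -> R[i]) :
  normc (\sum_(i <- s) F i) <= \sum_(i <- s) normc (F i).
Proof.
elim/big_ind2 : _ => //; first by rewrite normc0.
by move=> x1 x2 y1 y2 h1 h2; rewrite (le_trans (le_normcD _ _))// lerD.
Qed.

Lemma ReD z w : complex.Re (z + w) = complex.Re z + complex.Re w.
Proof. by case: z w => a b [c d]. Qed.

Lemma ImD z w : complex.Im (z + w) = complex.Im z + complex.Im w.
Proof. by case: z w => a b [c d]. Qed.

Lemma ReN z : complex.Re (- z) = - complex.Re z.
Proof. by case: z. Qed.

Lemma ImN z : complex.Im (- z) = - complex.Im z.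
Proof. by case: z. Qed.

Lemma ReM z w :
  complex.Re (z * w) = complex.Re z * complex.Re w - complex.Im z * complex.Im w.
Proof. by case: z w => a b [c d]. Qed.

Lemma ImM z w :
  complex.Im (z * w) = complex.Re z * complex.Im w + complex.Im z * complex.Re w.
Proof. by case: z w => a b [c d]. Qed.

Lemma Re_realM a z : complex.Re ((a%:C)%C * z) = a * complex.Re z.
Proof. by rewrite ReM /= mul0r subr0. Qed.

Lemma Re_sum (I : Type) (s : seq I) (F : I -> R[i]) :
  complex.Re (\sum_(i <- s) F i) = \sum_(i <- s) complex.Re (F i).
Proof. by elim/big_ind2 : _ => // x1 x2 y1 y2 <- <-; rewrite ReD. Qed.

Lemma Re_nat n : complex.Re (n%:R : R[i]) = n%:R.
Proof. by elim: n => // n IH; rewrite -!natr1 ReD IH. Qed.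

Lemma conjc_sum (I : Type) (s : seq I) (F : I -> R[i]) :
  conjc (\sum_(i <- s) F i) = \sum_(i <- s) conjc (F i).
Proof.
elim/big_ind2 : _ => //; first by rewrite conjc0.
by move=> x1 x2 y1 y2 <- <-; rewrite rmorphD.
Qed.

End complex_norm.

(** * Bounded measurable real and complex functions *)

Section bounded_measurable.
Context d {T : measurableType d} {R : realType}.
Implicit Types (g h : T -> R) (u v : T -> R[i]).

(** Boundedness holds at every point, which keeps the class stable under products and nonnegative
    powers; on a finite measure each member is integrable, so the integrals of trigonometric sums
    can be handled as real numbers. *)
Definition bounded_measurable g :=
  measurable_fun [set: T] g /\ exists M, forall t, `|g t| <= M.

Lemma bounded_measurable_cst a : bounded_measurable (fun=> a).
Proof. by split; [exact: measurable_cst|exists `|a|]. Qed.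

Lemma bounded_measurableD g h : bounded_measurable g -> bounded_measurable h ->
  bounded_measurable (fun t => g t + h t).
Proof.
move=> [mg [M gM]] [mh [N hN]]; split; first exact: measurable_funD.
by exists (M + N) => t; rewrite (le_trans (ler_normD _ _))// lerD.
Qed.

Lemma bounded_measurableM g h : bounded_measurable g -> bounded_measurable h ->
  bounded_measurable (fun t => g t * h t).
Proof.
move=> [mg [M gM]] [mh [N hN]]; split; first exact: measurable_funM.
by exists (M * N) => t; rewrite normrM ler_pM.
Qed.

Lemma bounded_measurableZ a g : bounded_measurable g ->
  bounded_measurable (fun t => a * g t).
Proof. exact/bounded_measurableM/bounded_measurable_cst. Qed.

Lemma bounded_measurable_powR g r : (forall t, 0 <= g t) -> 0 <= r ->
  bounded_measurable g -> bounded_measurable (fun t => g t `^ r).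
Proof.
move=> g0 r0 [mg [M gM]]; split.
  exact: (measurableT_comp (measurable_powR _)).
exists (M `^ r) => t; rewrite ger0_norm ?powR_ge0//.
have gtM : g t <= M by rewrite (le_trans (ler_norm _)).
by apply: ge0_ler_powR; rewrite ?nnegrE// (le_trans (g0 t)).
Qed.

Definition cbounded_measurable u :=
  bounded_measurable (fun t => complex.Re (u t)) /\ bounded_measurable (fun t => complex.Im (u t)).

Lemma cbounded_measurable_cst z : cbounded_measurable (fun=> z).
Proof. by split; exact: bounded_measurable_cst. Qed.

Lemma cbounded_measurableD u v : cbounded_measurable u -> cbounded_measurable v ->
  cbounded_measurable (fun t => u t + v t).
Proof.
move=> [u1 u2] [v1 v2]; split.
  by under eq_fun do rewrite ReD; exact: bounded_measurableD.
by under eq_fun do rewrite ImD; exact: bounded_measurableD.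
Qed.

Lemma cbounded_measurableM u v : cbounded_measurable u -> cbounded_measurable v ->
  cbounded_measurable (fun t => u t * v t).
Proof.
move=> [u1 u2] [v1 v2]; split.
  under eq_fun do rewrite ReM -mulN1r.
  by apply/bounded_measurableD/bounded_measurableZ; exact: bounded_measurableM.
under eq_fun do rewrite ImM.
by apply: bounded_measurableD; exact: bounded_measurableM.
Qed.

Lemma cbounded_measurable_conj u : cbounded_measurable u ->
  cbounded_measurable (fun t => conjc (u t)).
Proof.
move=> [u1 u2]; split.
  by apply: eq_ind u1 _ _; apply: funext => t /=; case: (u t).
apply: eq_ind (bounded_measurableZ (-1) u2) _ _.
by apply: funext => t /=; rewrite mulN1r; case: (u t).
Qed.

Lemma cbounded_measurable_real g : bounded_measurable g ->
  cbounded_measurable (fun t => (g t)%:C)%C.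
Proof. by move=> gB; split => //; exact: bounded_measurable_cst. Qed.

Lemma cbounded_measurable_sum (I : Type) (s : seq I) (F : I -> T -> R[i]) :
  (forall i, cbounded_measurable (F i)) ->
  cbounded_measurable (fun t => \sum_(i <- s) F i t).
Proof.
move=> FB; elim: s => [|i s IH].
  by under eq_fun do rewrite big_nil; exact: cbounded_measurable_cst.
by under eq_fun do rewrite big_cons; exact: cbounded_measurableD.
Qed.

Lemma measurable_normc u : measurable_fun [set: T] (fun t => complex.Re (u t)) ->
  measurable_fun [set: T] (fun t => complex.Im (u t)) ->
  measurable_fun [set: T] (fun t => normc (u t)).
Proof.
move=> u1 u2.
suff -> : (fun t => normc (u t)) =
    (fun t => (complex.Re (u t) ^+ 2 + complex.Im (u t) ^+ 2) `^ 2^-1).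
  apply: (measurableT_comp (measurable_powR _)).
  by apply: measurable_funD; exact: measurable_funX.
apply: funext => t /=; rewrite powR12_sqrt ?addr_ge0 ?sqr_ge0//.
by case: (u t).
Qed.

Lemma bounded_measurable_normc u : cbounded_measurable u ->
  bounded_measurable (fun t => normc (u t)).
Proof.
move=> [[u1 [M uM]] [u2 [N uN]]]; split; first exact: measurable_normc.
exists (M + N) => t; rewrite (ger0_norm (normc_ge0 _)).
by rewrite (le_trans (normc_le_add _))// lerD.
Qed.

End bounded_measurable.

(** * Normalized integrals *)

Section mean.
Context d {T : measurableType d} {R : realType}.
Variables (mu : {measure set T -> \bar R}) (c : {posnum R}).
Hypothesis muT : mu [set: T] = (c%:num^-1)%:E.
Implicit Types (g h : T -> R) (u v : T -> R[i]).

Lemma bounded_measurable_integrable g : bounded_measurable g ->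
  mu.-integrable [set: T] (EFin \o g).
Proof.
move=> [mg [M gM]]; apply: measurable_bounded_integrable => //.
  by rewrite muT ltry.
exists M; split; first exact: num_real.
by move=> N MN t _; exact: le_trans (gM t) (ltW MN).
Qed.

(** As [mu] has total mass [1 / c], the factor [c] makes this a probability average, and the
    constants of the inequalities below become one. *)
Definition mean g : R := c%:num * \int[mu]_t g t.

Lemma integral_mean g : bounded_measurable g ->
  (\int[mu]_t (g t)%:E = (mean g / c%:num)%:E)%E.
Proof.
move=> gB; rewrite /mean mulrAC divff ?gt_eqF// mul1r /Rintegral fineK//.
exact/integrable_fin_num/bounded_measurable_integrable.
Qed.

Lemma meanD g h : bounded_measurable g -> bounded_measurable h ->
  mean (fun t => g t + h t) = mean g + mean h.
Proof.
move=> gB hB.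
by rewrite /mean RintegralD// ?mulrDr//; exact: bounded_measurable_integrable.
Qed.

Lemma meanZ a g : bounded_measurable g -> mean (fun t => a * g t) = a * mean g.
Proof.
move=> gB; rewrite /mean RintegralZl//; last exact: bounded_measurable_integrable.
by rewrite mulrCA.
Qed.

Lemma mean_cst a : mean (fun=> a) = a.
Proof. by rewrite /mean Rintegral_cst// muT /= mulrCA divff ?gt_eqF// mulr1. Qed.

Lemma le_mean g h : bounded_measurable g -> bounded_measurable h ->
  (forall t, g t <= h t) -> mean g <= mean h.
Proof.
move=> gB hB gh; rewrite /mean ler_pM2l//.
by apply: le_Rintegral => //; exact: bounded_measurable_integrable.
Qed.

Lemma mean_ge0 g : (forall t, 0 <= g t) -> 0 <= mean g.
Proof. by move=> g0; rewrite mulr_ge0// Rintegral_ge0. Qed.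

Lemma eq_mean g h : g =1 h -> mean g = mean h.
Proof. by move=> /funext ->. Qed.

Definition cmean u : R[i] :=
  (mean (fun t => complex.Re (u t)) +i* mean (fun t => complex.Im (u t)))%C.

Lemma eq_cmean u v : u =1 v -> cmean u = cmean v.
Proof. by move=> /funext ->. Qed.

Lemma cmeanD u v : cbounded_measurable u -> cbounded_measurable v ->
  cmean (fun t => u t + v t) = cmean u + cmean v.
Proof.
move=> [u1 u2] [v1 v2]; apply/eqP; rewrite eq_complex /= -!meanD//.
by apply/andP; split; apply/eqP/eq_mean => t /=; rewrite (ReD, ImD).
Qed.

Lemma cmeanZ z u : cbounded_measurable u ->
  cmean (fun t => z * u t) = z * cmean u.
Proof.
move=> [u1 u2]; apply/eqP; rewrite eq_complex ReM ImM /= -mulNr -!meanZ//.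
rewrite -!meanD//; do ?exact: bounded_measurableZ.
by apply/andP; split; apply/eqP/eq_mean => t /=; rewrite (ReM, ImM) ?mulNr.
Qed.

Lemma cmean_sum (I : Type) (s : seq I) (F : I -> T -> R[i]) :
  (forall i, cbounded_measurable (F i)) ->
  cmean (fun t => \sum_(i <- s) F i t) = \sum_(i <- s) cmean (F i).
Proof.
move=> FB; elim: s => [|i s IH].
  under eq_cmean do rewrite big_nil.
  by rewrite big_nil; congr Complex; exact: mean_cst.
under eq_cmean do rewrite big_cons.
by rewrite big_cons cmeanD ?IH//; exact: cbounded_measurable_sum.
Qed.

Lemma cmean_conj u : cbounded_measurable u ->
  cmean (fun t => conjc (u t)) = conjc (cmean u).
Proof.
move=> [u1 u2]; apply/eqP; rewrite eq_complex /= -mulN1r -meanZ//.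
by apply/andP; split; apply/eqP/eq_mean => t /=; case: (u t) => a b //=; rewrite mulN1r.
Qed.

Lemma Re_cmean u : complex.Re (cmean u) = mean (fun t => complex.Re (u t)).
Proof. by []. Qed.

End mean.

#[global] Arguments mean : simpl never.
#[global] Arguments cmean : simpl never.

(** * Inequalities between powers *)

Section power_inequalities.
Context {R : realType}.
Implicit Types a b x y p r s : R.

Lemma ltr_ln_subr1 x : 0 < x -> x != 1 -> ln x < x - 1.
Proof.
move=> x0 x1; rewrite -ltr_expR lnK ?posrE//.
by rewrite (le_lt_trans _ (expR_gt1Dx _)) ?subr_eq0// addrC subrK.
Qed.

Lemma ler_ln_subr1 x : 0 < x -> ln x <= x - 1.
Proof.
move=> x0; have [->|x1] := eqVneq x 1; first by rewrite ln1 subrr.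
exact/ltW/ltr_ln_subr1.
Qed.

(** The equality case of Young's inequality. For [A = a ^ p], [B = b ^ r] and [m = a b], the sum of
    [ln (A / m)] and [ln (B / m)] with weights [1 / p] and [1 / r] is zero. By [ln x <= x - 1] it is
    at most a nonpositive number, and strictly less unless both ratios are one. *)
Lemma conjugate_powR_eq a b p r : 0 <= a -> 0 <= b -> 0 < p -> 0 < r ->
  p^-1 + r^-1 = 1 -> a `^ p / p + b `^ r / r <= a * b -> a `^ p = b `^ r.
Proof.
move=> a0 b0 p0 r0 pr le_ab.
have [a_eq0|an0] := eqVneq a 0.
  move: le_ab; rewrite a_eq0 mul0r powR0 ?gt_eqF// mul0r add0r => h.
  apply/eqP; rewrite eq_le powR_ge0 /=.
  by rewrite -(@ler_pM2r _ r^-1) ?invr_gt0// mul0r.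
have [b_eq0|bn0] := eqVneq b 0.
  move: le_ab; rewrite b_eq0 mulr0 (@powR0 _ r) ?gt_eqF// mul0r addr0 => h.
  apply/eqP; rewrite eq_le powR_ge0 andbT.
  by rewrite -(@ler_pM2r _ p^-1) ?invr_gt0// mul0r.
have {a0}a0 : 0 < a by rewrite lt_neqAle eq_sym an0.
have {b0}b0 : 0 < b by rewrite lt_neqAle eq_sym bn0.
set A := a `^ p in le_ab *; set B := b `^ r in le_ab *.
have A0 : 0 < A by rewrite powR_gt0.
have B0 : 0 < B by rewrite powR_gt0.
pose m := a * b; have m0 : 0 < m by rewrite mulr_gt0.
have lnm : p^-1 * ln (A / m) + r^-1 * ln (B / m) = 0.
  rewrite !ln_div ?posrE// /A /B !ln_powR !mulrBr !mulrA !mulVf ?gt_eqF// !mul1r.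
  have -> : ln a - p^-1 * ln m + (ln b - r^-1 * ln m) =
    ln a + ln b - (p^-1 + r^-1) * ln m by ring.
  by rewrite pr mul1r /m lnM ?posrE// subrr.
have ub : p^-1 * (A / m - 1) + r^-1 * (B / m - 1) <= 0.
  have -> : p^-1 * (A / m - 1) + r^-1 * (B / m - 1) =
    (A / p + B / r) / m - (p^-1 + r^-1) by ring.
  by rewrite pr subr_le0 ler_pdivrMr// mul1r.
have [Am|Am] := eqVneq (A / m) 1; last first.
  have : p^-1 * ln (A / m) + r^-1 * ln (B / m) < 0.
    apply: lt_le_trans ub; apply: ltr_leD.
      by rewrite ltr_pM2l ?invr_gt0// ltr_ln_subr1// divr_gt0.
    by rewrite ler_pM2l ?invr_gt0// ler_ln_subr1// divr_gt0.
  by rewrite lnm ltxx.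
have [Bm|Bm] := eqVneq (B / m) 1.
  by rewrite (divr1_eq Am) (divr1_eq Bm).
have : p^-1 * ln (A / m) + r^-1 * ln (B / m) < 0.
  apply: lt_le_trans ub; apply: ler_ltD.
    by rewrite ler_pM2l ?invr_gt0// ler_ln_subr1// divr_gt0.
  by rewrite ltr_pM2l ?invr_gt0// ltr_ln_subr1// divr_gt0.
by rewrite lnm ltxx.
Qed.

(** Young's inequality for the exponents [1 / a] and [1 / (1 - a)]. It replaces Hoelder's inequality
    below: it is applied pointwise or termwise to normalized quantities and then summed or
    integrated. *)
Lemma weighted_AGM x y a : 0 <= x -> 0 <= y -> 0 <= a <= 1 ->
  x `^ a * y `^ (1 - a) <= a * x + (1 - a) * y.
Proof.
move=> x0 y0 /andP[a0 a1].
have [->|an0] := eqVneq a 0; first by rewrite powRr0 subr0 powRr1// !mul1r mul0r add0r.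
have [->|an1] := eqVneq a 1.
  by rewrite subrr powRr0 powRr1// mulr1 mul1r mul0r addr0.
have {}a0 : 0 < a by rewrite lt_neqAle eq_sym an0.
have {}a1 : 0 < 1 - a by rewrite subr_gt0 lt_neqAle an1.
have := @conjugate_powR R (x `^ a) (y `^ (1 - a)) a^-1 (1 - a)^-1
  (powR_ge0 _ _) (powR_ge0 _ _).
rewrite !invr_gt0 !invrK => /(_ a0 a1); rewrite addrC subrK => /(_ erefl).
rewrite -!powRrM !divff ?gt_eqF// !powRr1// => /le_trans; apply.
by rewrite mulrC (mulrC y).
Qed.

Lemma powRV a r : 0 <= a -> a^-1 `^ r = (a `^ r)^-1.
Proof. by move=> a0; rewrite -(powR_inv1 a0) -powRrM mulN1r powRN. Qed.

(** Convexity of the power: the graph lies above its tangent at [a]. This is the weighted mean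
    inequality for [b ^ r] and [a ^ r] with weights [1 / r] and [1 - 1 / r], multiplied by [r]. *)
Lemma powR_tangent a b r : 0 <= a -> 0 <= b -> 1 <= r ->
  a `^ r + r * a `^ (r - 1) * (b - a) <= b `^ r.
Proof.
move=> a0 b0 r1; have r0 : 0 < r by exact: lt_le_trans r1.
have := @weighted_AGM (b `^ r) (a `^ r) r^-1 (powR_ge0 _ _) (powR_ge0 _ _).
rewrite invr_ge0 (ltW r0) invf_le1// r1 => /(_ isT).
rewrite -!powRrM divff ?gt_eqF// powRr1// mulrBr mulr1 divff ?gt_eqF//.
rewrite -(@ler_pM2l _ r)// mulrDr !mulrA mulrBr mulr1 divff ?gt_eqF// mul1r.
have ar : a * a `^ (r - 1) = a `^ r by rewrite mulr_powRB1.
move=> h; have -> : a `^ r + r * a `^ (r - 1) * (b - a) =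
  r * b * a `^ (r - 1) - (r - 1) * a `^ r by rewrite -ar; ring.
lra.
Qed.

(** The tangent at the larger of the two points bounds the difference. *)
Lemma powR_lipschitz (K a b r : R) : 0 <= a <= K -> 0 <= b <= K -> 1 <= r ->
  `|a `^ r - b `^ r| <= r * K `^ (r - 1) * `|a - b|.
Proof.
move=> /andP[a0 aK] /andP[b0 bK] r1.
wlog ba : a b a0 aK b0 bK / b <= a.
  by move=> H; have [/H|/ltW/H] := leP b a; last rewrite distrC (distrC a); apply.
have r0 : 0 < r by exact: lt_le_trans r1.
rewrite (ger0_norm (_ : 0 <= a - b)) ?subr_ge0// ger0_norm; last first.
  by rewrite subr_ge0 ge0_ler_powR// ltW.
apply: (@le_trans _ _ (r * a `^ (r - 1) * (a - b))).
  by have := powR_tangent a0 b0 r1; lra.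
rewrite ler_wpM2r ?subr_ge0// ler_wpM2l ?(ltW r0)//.
by rewrite ge0_ler_powR// ?subr_ge0 ?nnegrE// (le_trans a0).
Qed.

Lemma bernoulli_le x n : 0 <= x -> 1 + n%:R * x <= (1 + x) ^+ n.
Proof.
move=> x0; elim: n => [|n IH]; first by rewrite mul0r addr0 expr0.
rewrite exprS (le_trans _ (ler_wpM2l _ IH)) ?addr_ge0//.
have : 0 <= n%:R * x * x by rewrite !mulr_ge0.
by rewrite -natr1; nra.
Qed.

(** By Bernoulli's inequality the powers of a number above one are unbounded. The exponents [2 ^ k]
    are those that arise from squaring a bound [k] times. *)
Lemma expr2n_bounded_le1 x y : (forall k, x ^+ (2 ^ k) <= y) -> x <= 1.
Proof.
move=> xy; rewrite leNgt; apply/negP => x1.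
pose n := Num.truncn (y / (x - 1)).
have := xy n; rewrite leNgt => /negP; apply.
have n2 : (n.+1 <= 2 ^ n)%N by exact: ltn_expl.
have x10 : 0 < x - 1 by rewrite subr_gt0.
have : y < n.+1%:R * (x - 1) by rewrite -ltr_pdivrMr// truncnS_gt.
move=> /lt_le_trans; apply; apply: (@le_trans _ _ (x ^+ n.+1)).
  rewrite -{2}(subrK 1 x) (addrC _ 1).
  by rewrite (le_trans _ (bernoulli_le _ (ltW x10)))// lerDr.
by rewrite ler_weXn2l// ltW.
Qed.

End power_inequalities.

(** * A continuity criterion on finite products of the real line *)

Section locally_lipschitz.
Context {R : realType} {J : finType}.

Lemma locally_lipschitz_continuous (F : prod_topology (fun _ : J => R : topologicalType) -> R) :
  (forall K, exists L, forall x y, (forall j, `|x j| <= K) ->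
     (forall j, `|y j| <= K) -> `|F x - F y| <= L * \sum_j `|x j - y j|) ->
  continuous F.
Proof.
(* The cube of radius [K] contains [x] and every point whose coordinates differ from those of [x] by
   less than one. *)
move=> FL x; pose K := \sum_j `|x j| + 1.
have xK j : `|x j| + 1 <= K by rewrite lerD2r (bigD1 j)//= lerDl sumr_ge0.
have [L FK] := FL K.
apply/(@cvgrPdist_le R R _ (nbhs x) _ F (F x)) => e e0.
(* Adding one to both factors keeps [D] positive even if [L] is zero or [J] is empty. *)
pose D := (`|L| + 1) * #|J|.+1%:R.
have D0 : 0 < D by rewrite mulr_gt0// ltr_wpDl.
have dl0 : 0 < Order.min 1 (e / D) by rewrite lt_min ltr01 divr_gt0.
have : nbhs x [set y | forall j, `|x j - y j| < Order.min 1 (e / D)].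
  apply: (@filter_forall _ J _ (nbhs x)) => j.
  have /(@cvgrPdist_lt R R _ (nbhs x) _ _ _) := @proj_continuous J (fun=> R) j x.
  exact.
apply: (@filterS _ (nbhs x) _) => y /= xy.
have yK j : `|y j| <= K.
  rewrite (le_trans _ (xK j))// -(subrKC (x j) (y j)).
  rewrite (le_trans (ler_normD _ _))// lerD2l distrC.
  by have := xy j; rewrite lt_min => /andP[/ltW].
rewrite (le_trans (FK x y _ yK))//; first by move=> j; rewrite (le_trans _ (xK j))// lerDl.
apply: (@le_trans _ _ (`|L| * \sum_j (e / D))).
  rewrite (@le_trans _ _ (`|L| * \sum_j `|x j - y j|))//.
    by rewrite ler_wpM2r ?ler_norm ?sumr_ge0.
  apply: ler_wpM2l => //; apply: ler_sum => j _.
  by have := xy j; rewrite lt_min => /andP[_ /ltW].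
rewrite sumr_const -mulr_natr.
have -> : `|L| * (e / D * #|J|%:R) = `|L| * #|J|%:R * e / D by ring.
rewrite ler_pdivrMr// mulrC ler_pM2l//.
by rewrite /D ler_pM// ?ler_nat// lerDl.
Qed.

End locally_lipschitz.

(** * The Hausdorff-Young inequality for finite orthonormal sums *)

Section hausdorff_young.
Context d {T : measurableType d} {R : realType}.
Variables (mu : {measure set T -> \bar R}) (c : {posnum R}).
Hypothesis muT : mu [set: T] = (c%:num^-1)%:E.
Local Notation mean := (mean mu c).
Local Notation cmean := (cmean mu c).
Variables (I : finType) (phi : I -> T -> R[i]).
Hypothesis phi_bounded : forall i, cbounded_measurable (phi i).
Hypothesis phi_le1 : forall i t, normc (phi i t) <= 1.
Hypothesis phi_orthonormal : forall i j,
  cmean (fun t => phi i t * conjc (phi j t)) = (i == j)%:R.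
Implicit Types (f h : I -> R[i]) (g : T -> R[i]).

Definition synth f t : R[i] := \sum_i f i * phi i t.

Definition coef g i : R[i] := cmean (fun t => g t * conjc (phi i t)).

Lemma synth_bounded f : cbounded_measurable (synth f).
Proof.
apply: cbounded_measurable_sum => i; apply: cbounded_measurableM => //.
exact: cbounded_measurable_cst.
Qed.

Lemma normc_synth f t : normc (synth f t) <= \sum_i normc (f i).
Proof.
rewrite (le_trans (normc_sum _ _))// ler_sum// => i _.
by rewrite normcM ler_piMr ?normc_ge0.
Qed.

(** [synth] and [coef] are adjoint to each other for the pairings by the sum over [I] and by the
    mean. *)
Lemma synth_pairing f g : cbounded_measurable g ->
  cmean (fun t => synth f t * conjc (g t)) = \sum_i f i * conjc (coef g i).
Proof.
move=> gB; have gJB := cbounded_measurable_conj gB.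
have fB i : cbounded_measurable (fun t => phi i t * conjc (g t)).
  exact: cbounded_measurableM.
under eq_cmean => t do rewrite /synth mulr_suml.
rewrite cmean_sum//; last first.
  move=> i; under eq_fun => t do rewrite -mulrA.
  by apply: cbounded_measurableM => //; exact: cbounded_measurable_cst.
apply: eq_bigr => i _; under eq_cmean => t do rewrite -mulrA.
rewrite cmeanZ// /coef -cmean_conj//; last first.
  by apply: cbounded_measurableM => //; exact: cbounded_measurable_conj.
by congr (_ * _); apply: eq_cmean => t; rewrite rmorphM /= conjcK mulrC.
Qed.

Lemma coef_basis i j : coef (phi i) j = (i == j)%:R.
Proof. exact: phi_orthonormal. Qed.

#[local] Arguments conjc : simpl never.

Lemma coef_synth f i : coef (synth f) i = f i.
Proof.
rewrite /coef synth_pairing// (bigD1 i)//= big1 => [|j ji].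
  by rewrite addr0 coef_basis eqxx conjc1 mulr1.
by rewrite coef_basis eq_sym (negbTE ji) conjc0 mulr0.
Qed.

Lemma mean_normc_sqr g : mean (fun t => normc (g t) ^+ 2) =
  complex.Re (cmean (fun t => g t * conjc (g t))).
Proof. by rewrite Re_cmean; apply: eq_mean => t; rewrite mul_conjc. Qed.

Lemma sqr_bounded g : cbounded_measurable g ->
  bounded_measurable (fun t => normc (g t) ^+ 2).
Proof.
move=> gB; under eq_fun do rewrite expr2.
by apply: bounded_measurableM; exact: bounded_measurable_normc.
Qed.

Lemma synth_parseval f :
  mean (fun t => normc (synth f t) ^+ 2) = \sum_i normc (f i) ^+ 2.
Proof.
rewrite mean_normc_sqr synth_pairing; last exact: synth_bounded.
by rewrite Re_sum; apply: eq_bigr => i _; rewrite coef_synth mul_conjc.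
Qed.

(** For [u = coef g] the mean of [|g - Su| ^ 2] is nonnegative. By adjointness the cross term is
    [-2] times the sum of [|u_i| ^ 2], and by Parseval the last term is that sum itself. *)
Lemma bessel g : cbounded_measurable g ->
  \sum_i normc (coef g i) ^+ 2 <= mean (fun t => normc (g t) ^+ 2).
Proof.
move=> gB; set u := coef g; have SB := synth_bounded u.
have : 0 <= mean (fun t => normc (g t) ^+ 2 +
    ((-2) * complex.Re (synth u t * conjc (g t)) + normc (synth u t) ^+ 2)).
  apply: mean_ge0 => t; rewrite !sqr_normcE.
  case: (g t) (synth u t) => a b [a' b'] /=.
  have := sqr_ge0 (a - a'); have := sqr_ge0 (b - b'); lra.
have pB : bounded_measurable (fun t => complex.Re (synth u t * conjc (g t))).
  by apply: (cbounded_measurableM _ _).1 => //; exact: cbounded_measurable_conj.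
rewrite !meanD//; [|exact: bounded_measurableZ|exact: sqr_bounded|exact: sqr_bounded|].
- rewrite meanZ// synth_parseval -Re_cmean synth_pairing// Re_sum.
  under eq_bigr => i _ do rewrite mul_conjc /=.
  lra.
- by apply: bounded_measurableD; [exact: bounded_measurableZ|exact: sqr_bounded].
Qed.

(** The power [p] of the l^p norm; the root is left out because only the condition of lying in the
    unit ball and homogeneity matter. *)
Definition lpsum p f : R := \sum_i normc (f i) `^ p.

Definition moment r f : R := mean (fun t => normc (synth f t) `^ r).

Lemma powR_synth_bounded f r : 0 <= r ->
  bounded_measurable (fun t => normc (synth f t) `^ r).
Proof.
move=> r0; apply: bounded_measurable_powR => //.
- by move=> t; exact: normc_ge0.
- exact/bounded_measurable_normc/synth_bounded.
Qed.

Lemma synthZ (k : R) f t :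
  synth (fun i => (k%:C)%C * f i) t = (k%:C)%C * synth f t.
Proof. by rewrite /synth mulr_sumr; apply: eq_bigr => i _; rewrite mulrA. Qed.

Lemma momentZ (k : R) r f : 0 <= k -> 0 <= r ->
  moment r (fun i => (k%:C)%C * f i) = k `^ r * moment r f.
Proof.
move=> k0 r0; rewrite /moment -meanZ//; last exact: powR_synth_bounded.
apply: eq_mean => t.
by rewrite synthZ normcM normc_real ger0_norm// powRM// normc_ge0.
Qed.

Lemma lpsumZ (k : R) p f : 0 <= k ->
  lpsum p (fun i => (k%:C)%C * f i) = k `^ p * lpsum p f.
Proof.
move=> k0; rewrite /lpsum mulr_sumr; apply: eq_bigr => i _.
by rewrite normcM normc_real ger0_norm// powRM// normc_ge0.
Qed.

Lemma lpsum_ge0 p f : 0 <= lpsum p f.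
Proof. by rewrite sumr_ge0// => i _; exact: powR_ge0. Qed.

Lemma moment_ge0 r f : 0 <= moment r f.
Proof. by apply: mean_ge0 => t; exact: powR_ge0. Qed.

Lemma lpsum_le1 p f i : 0 < p -> lpsum p f <= 1 -> normc (f i) <= 1.
Proof.
move=> p0 f1; rewrite leNgt; apply/negP => fi1.
have : normc (f i) `^ p <= 1.
  rewrite (le_trans _ f1)// /lpsum (bigD1 i)//= lerDl sumr_ge0// => j _.
  exact: powR_ge0.
apply/negP; rewrite -ltNge.
have : 1 `^ p < normc (f i) `^ p by rewrite gt0_ltr_powR// ?nnegrE ?normc_ge0.
by rewrite powR1.
Qed.

(** Pointwise [|Sf|] is at most the l^1 norm of [f], which Hoelder's inequality bounds by
    [n ^ (1 / r)] for [n] terms. The bound is crude, but it does not depend on [r], as the iteration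
    requires. *)
Lemma moment_card r f : 1 < r -> lpsum (r / (r - 1)) f <= 1 ->
  moment r f <= #|I|%:R.
Proof.
move=> r1 f1; have r0 : 0 < r by exact: lt_trans r1.
have r10 : 0 < r - 1 by rewrite subr_gt0.
have [I0|I0] := posnP #|I|.
  rewrite /moment (_ : (fun t => _) = fun=> 0) ?mean_cst ?I0//.
  apply: funext => t; rewrite /synth big1 ?normc0 ?powR0 ?gt_eqF// => i.
  by have := fintype0 i; rewrite I0 => /(_ erefl).
have n0 : 0 < #|I|%:R :> R by rewrite ltr0n.
rewrite -[leRHS](mean_cst muT).
apply: le_mean => //; [exact/powR_synth_bounded/ltW|exact: bounded_measurable_cst|].
move=> t; set n := #|I|%:R : R.
suff sn : normc (synth f t) <= n `^ r^-1.
  apply: (@le_trans _ _ ((n `^ r^-1) `^ r)).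
    by rewrite ge0_ler_powR ?nnegrE ?normc_ge0 ?powR_ge0 ?(ltW r0).
  by rewrite -powRrM mulVf ?gt_eqF// powRr1 ?(ltW n0).
rewrite (le_trans (normc_synth _ _))//.
pose p := r / (r - 1); have p0 : 0 < p by rewrite divr_gt0.
have pr : p^-1 + r^-1 = 1 by rewrite /p invf_div; field; rewrite !gt_eqF.
(* With [k ^ p = n], Young's inequality for each product of [k |f_i|] and [1] sums to at most
   [n / p + n / r = n]. *)
pose k := n `^ p^-1; have k0 : 0 < k by rewrite powR_gt0.
have kp : k `^ p = n by rewrite /k -powRrM mulVf ?gt_eqF// powRr1// ltW.
have : \sum_i (k * normc (f i)) <= n.
  apply: (@le_trans _ _ (\sum_i ((k * normc (f i)) `^ p / p + r^-1))).
    apply: ler_sum => i _.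
    have := @conjugate_powR R (k * normc (f i)) 1 p r _ ler01 p0 r0 pr.
    by rewrite mulr1 powR1 mul1r; apply; rewrite mulr_ge0 ?normc_ge0// ltW.
  rewrite big_split /= sumr_const -mulr_suml.
  under eq_bigr => i _ do rewrite powRM ?normc_ge0 ?(ltW k0)// kp.
  rewrite -mulr_sumr -mulr_natr -/n -[leRHS]mulr1 -pr mulrDr mulrC lerD//; last first.
    by rewrite mulrC.
  rewrite mulrC -!mulrA ler_pM2l// ler_pdivrMr// mulVf ?gt_eqF//.
rewrite -mulr_sumr => h.
rewrite -(@ler_pM2l _ k)// (le_trans h)// /k -powRD ?pr ?powRr1 ?(ltW n0)//.
by rewrite oner_eq0.
Qed.

(** The unit ball is a closed subset of a cube, compact by Tychonoff's theorem, and the moment is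
    continuous on it. *)
Lemma exists_maximizer r : 1 < r ->
  exists2 f, lpsum (r / (r - 1)) f <= 1 &
    forall h, lpsum (r / (r - 1)) h <= 1 -> moment r h <= moment r f.
Proof.
move=> r1; set p := r / (r - 1).
have r0 : 0 < r by exact: lt_trans r1.
have r10 : 0 < r - 1 by rewrite subr_gt0.
have p0 : 0 < p by rewrite divr_gt0.
have p1 : 1 <= p by rewrite ler_pdivlMr// mul1r lerBlDr lerDl.
(* A complex vector is encoded by its real coordinates: [true] selects real parts, [false] imaginary
   parts. *)
pose X := prod_topology (fun _ : I * bool => R : topologicalType).
pose F (x : X) i : R[i] := (x (i, true) +i* x (i, false))%C.
have FK (K : R) (x : X) i : (forall j, `|x j| <= K) -> normc (F x i) <= K + K.
  by move=> xK; rewrite (le_trans (normc_le_add _))//= lerD.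
have FD (x y : X) : \sum_i normc (F x i - F y i) <= \sum_j `|x j - y j|.
  rewrite (eq_bigr (fun j => `|x (j.1, j.2) - y (j.1, j.2)|)); last by case.
  rewrite -(pair_big xpredT xpredT (fun i b => `|x (i, b) - y (i, b)|)).
  by apply: ler_sum => i _; apply: (le_trans (normc_le_add _)); rewrite big_bool.
have cN : continuous (fun x : X => lpsum p (F x)).
  apply: locally_lipschitz_continuous => K.
  exists (p * (K + K) `^ (p - 1)) => x y xK yK.
  apply: (@le_trans _ _ (p * (K + K) `^ (p - 1) * \sum_i normc (F x i - F y i))).
    rewrite /lpsum -sumrB mulr_sumr (le_trans (ler_norm_sum _ _ _))//.
    apply: ler_sum => i _.
    rewrite (le_trans (@powR_lipschitz _ (K + K) _ _ _ _ _ p1)) ?normc_ge0 ?FK//.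
    by rewrite ler_wpM2l ?ler_dist_normc// mulr_ge0 ?powR_ge0// ltW.
  by rewrite ler_wpM2l// mulr_ge0 ?powR_ge0// ltW.
have cJ : continuous (fun x : X => moment r (F x)).
  apply: locally_lipschitz_continuous => K; pose L := \sum_(i : I) (K + K).
  exists (r * L `^ (r - 1)) => x y xK yK.
  have SL z : (forall j, `|z j| <= K) -> forall t, 0 <= normc (synth (F z) t) <= L.
    move=> zK t; rewrite normc_ge0 (le_trans (normc_synth _ _))//.
    by apply: ler_sum => i _; exact: FK.
  have r10' : 0 <= r * L `^ (r - 1) by rewrite mulr_ge0 ?powR_ge0// ltW.
  apply: (@le_trans _ _ (r * L `^ (r - 1) * \sum_i normc (F x i - F y i))); last first.
    by rewrite ler_wpM2l.
  (* A one-sided estimate suffices, since exchanging the two vectors gives the other side. *)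
  have le_moment u v : (forall j, `|u j| <= K) -> (forall j, `|v j| <= K) ->
      moment r (F u) <= r * L `^ (r - 1) * \sum_i normc (F u i - F v i) +
                        moment r (F v).
    move=> uK vK; rewrite -[X in _ <= X + _](mean_cst muT) -meanD//; last 2 first.
    - exact: bounded_measurable_cst.
    - exact/powR_synth_bounded/ltW.
    apply: le_mean => //.
    - exact/powR_synth_bounded/ltW.
    - apply: bounded_measurableD; first exact: bounded_measurable_cst.
      exact/powR_synth_bounded/ltW.
    move=> t; rewrite -lerBlDr (le_trans (ler_norm _))//.
    rewrite (le_trans (powR_lipschitz (SL _ uK t) (SL _ vK t) (ltW r1)))//.
    rewrite ler_wpM2l// (le_trans (ler_dist_normc _ _))//.
    apply: le_trans (normc_synth (fun i => F u i - F v i) t).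
    by rewrite /synth -sumrB; under eq_bigr do rewrite -mulrBl.
  have sumC : \sum_i normc (F y i - F x i) = \sum_i normc (F x i - F y i).
    by apply: eq_bigr => i _; rewrite -normcN opprB.
  have := le_moment y x yK xK; rewrite sumC.
  have := le_moment x y xK yK.
  move: (moment r (F x)) (moment r (F y)) (\sum_i _) (r * _) => u v w k h1 h2.
  by rewrite ler_norml; apply/andP; split; lra.
pose A := [set x : X | lpsum p (F x) <= 1].
have A0 : A !=set0.
  exists (fun=> 0); rewrite /A /= /lpsum big1 ?ler01// => i _.
  have -> : F (fun=> 0) i = 0 by [].
  by rewrite normc0 powR0// gt_eqF.
have cA : compact A.
  pose B := [set x : X | forall j, (`[-1, 1]%classic : set R) (x j)].
  apply: (@subclosed_compact X A B).
  - rewrite (_ : A = (fun x => lpsum p (F x)) @^-1` [set y | y <= 1])//.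
    by apply: closed_comp => [x _|]; [exact: cN|exact: closed_le].
  - apply: (@tychonoff _ (fun=> R) (fun=> `[-1, 1]%classic)) => j.
    exact: segment_compact.
  - move=> x xA [i b]; have := lpsum_le1 i p0 xA.
    move=> Fi1; suff : `|x (i, b)| <= 1 by rewrite /= in_itv /= -ler_norml.
    apply: le_trans Fi1.
    rewrite -(@ler_pXn2r _ 2)// ?nnegrE ?normc_ge0// sqr_normcE real_normK ?num_real//=.
    by case: b; rewrite (lerDl, lerDr) sqr_ge0.
have [x xA xmax] := compact_EVT_max A0 cA (continuous_subspaceT cJ).
exists (F x); first exact: set_mem xA.
move=> h hA; pose y : X := fun j => if j.2 then complex.Re (h j.1) else complex.Im (h j.1).
have Fy : F y = h by apply: funext => i; rewrite /F /y /=; case: (h i).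
rewrite -Fy; apply: (xmax y); apply/mem_set.
by rewrite /A /mkset Fy.
Qed.

(* Exponents: with [s = 2r - 2] and [s' = s / (s - 1)], the exponent [s'] is
   the convex combination of [2 (p - 1)] and [p] with weight [1 / (s - 1)]. *)
Lemma lpsum_interpolation r f (s := 2 * r - 2) :
  2 <= r -> lpsum (r / (r - 1)) f <= 1 ->
  lpsum (s / (s - 1)) f `^ (s - 1) <= lpsum (2 * (r / (r - 1) - 1)) f.
Proof.
move=> r2; set p := r / (r - 1) => f1; set Q := lpsum (2 * (p - 1)) f.
have r10 : 0 < r - 1 by lra.
have s10 : 0 < s - 1 by rewrite /s; lra.
have p1E : p - 1 = (r - 1)^-1 by rewrite /p; field; rewrite gt_eqF.
have p10 : 0 < p - 1 by rewrite p1E invr_gt0.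
have s'0 : 0 < s / (s - 1) by rewrite divr_gt0// /s; lra.
have [Q0|Qn0] := eqVneq Q 0.
  have f0 i : normc (f i) = 0.
    have /eqP := Q0; rewrite psumr_eq0 => [/allP/(_ i (mem_index_enum _))/eqP|j _].
      exact: powR_eq0_eq0.
    exact: powR_ge0.
  rewrite Q0 /lpsum big1 ?powR0 ?gt_eqF// => i _.
  by rewrite f0 powR0 ?gt_eqF.
have Q0 : 0 < Q by rewrite lt_neqAle eq_sym Qn0 lpsum_ge0.
pose a := (s - 1)^-1.
have a0 : 0 < a by rewrite invr_gt0.
have a1 : a <= 1 by rewrite invf_le1// /s; lra.
have expE : 2 * (p - 1) * a + p * (1 - a) = s / (s - 1).
  by rewrite /a /p /s; field; rewrite !gt_eqF//; lra.
(* Hoelder's inequality in termwise form: division by [Q] makes the first terms sum to one, and the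
   terms with exponent [p] sum to at most one by hypothesis. *)
have fi i : normc (f i) `^ (s / (s - 1)) <=
    Q `^ a * (a * (normc (f i) `^ (2 * (p - 1)) / Q) + (1 - a) * normc (f i) `^ p).
  set z := normc (f i); have z0 : 0 <= z by exact: normc_ge0.
  have := @weighted_AGM _ (z `^ (2 * (p - 1)) / Q) (z `^ p) a.
  rewrite divr_ge0 ?powR_ge0 ?(ltW Q0)// (ltW a0) a1 => /(_ isT isT isT) h.
  rewrite -expE powRD; last by rewrite expE (gt_eqF s'0).
  apply: le_trans (ler_wpM2l (powR_ge0 Q a) h).
  rewrite powRM ?powR_ge0 ?invr_ge0 ?(ltW Q0)// -!powRrM.
  rewrite mulrA [leRHS](_ : _ = (Q `^ a * Q^-1 `^ a) *
    (z `^ (2 * (p - 1) * a) * z `^ (p * (1 - a)))); last by ring.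
  by rewrite -powRM ?invr_ge0 ?(ltW Q0)// divff// powR1 mul1r.
apply: (@le_trans _ _ ((Q `^ a) `^ (s - 1))).
  rewrite ge0_ler_powR ?nnegrE ?lpsum_ge0 ?powR_ge0 ?(ltW s10)//.
  rewrite /lpsum (le_trans (ler_sum _ (fun i _ => fi i)))//.
  rewrite -mulr_sumr big_split /= -!mulr_sumr -mulr_suml -/(lpsum p f) -/(lpsum _ f) -/Q.
  rewrite divff// mulr1 ler_piMr ?powR_ge0//.
  by have := ler_wpM2l (_ : 0 <= 1 - a) f1; rewrite subr_ge0 => /(_ a1); lra.
by rewrite -powRrM mulVf ?gt_eqF// powRr1// ltW.
Qed.

(** Scaling by [k = N ^ (- 1 / p)] moves [f] to the unit sphere; undoing it costs [N ^ (s / p)], and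
    [s / p = s - 1]. *)
Lemma moment_homogeneous s M : 1 < s ->
  (forall h, lpsum (s / (s - 1)) h <= 1 -> moment s h <= M) ->
  forall f, moment s f <= M * lpsum (s / (s - 1)) f `^ (s - 1).
Proof.
move=> s1 hM f; set p := s / (s - 1) in hM *; set N := lpsum p f.
have s0 : 0 < s by exact: lt_trans s1.
have s10 : 0 < s - 1 by rewrite subr_gt0.
have p0 : 0 < p by rewrite divr_gt0.
have [N0|Nn0] := eqVneq N 0.
  have f0 i : f i = 0.
    apply: eq0_normc; apply: (@powR_eq0_eq0 _ _ p).
    have /eqP := N0; rewrite psumr_eq0 => [/allP/(_ i (mem_index_enum _))/eqP//|j _].
    exact: powR_ge0.
  rewrite N0 powR0 ?gt_eqF// mulr0 /moment (_ : (fun t => _) = fun=> 0) ?mean_cst//.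
  apply: funext => t; rewrite /synth big1 ?normc0 ?powR0 ?gt_eqF// => i _.
  by rewrite f0 mul0r.
have N0 : 0 < N by rewrite lt_neqAle eq_sym Nn0 lpsum_ge0.
pose k := N `^ (- p^-1); have k0 : 0 < k by rewrite powR_gt0.
have := hM (fun i => (k%:C)%C * f i).
rewrite lpsumZ ?(ltW k0)// momentZ ?(ltW k0) ?(ltW s0)// -/N.
rewrite {1}/k -powRrM mulNr mulVf ?gt_eqF// powR_inv1 ?(ltW N0)// mulVf// => /(_ (lexx _)).
rewrite -ler_pdivlMl ?powR_gt0// => /le_trans; apply.
rewrite /k -powRrM -powRN mulNr opprK.
have -> : p^-1 * s = s - 1 by rewrite /p; field; rewrite !gt_eqF.
by rewrite mulrC.
Qed.

(* F. Riesz: a maximizer [f] also maximizes the linear functional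
   [h |-> Re (sum h_i * conj u_i)], where [u] are the coefficients of
   [|Sf|^(r-2) Sf]; equality in Hoelder's inequality then forces
   [|u_i| = M |f_i|^(p-1)], and Bessel's inequality for [u] bounds [M^2] by the
   constant for the exponent [2r - 2]. *)
Lemma moment_sqr_le r M2 (s := 2 * r - 2) : 2 <= r -> 0 <= M2 ->
  (forall h, lpsum (s / (s - 1)) h <= 1 -> moment s h <= M2) ->
  forall h, lpsum (r / (r - 1)) h <= 1 -> moment r h ^+ 2 <= M2.
Proof.
move=> r2 M20 hM2 h0 h01.
have r1 : 1 < r by lra.
have r0 : 0 < r by lra.
have rr0 : 0 <= r - 2 by lra.
have r10 : 0 < r - 1 by lra.
have s1 : 1 < s by rewrite /s; lra.
have [f] := exists_maximizer r1.
set p := r / (r - 1) in h01 * => f1 fmax.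
have p0 : 0 < p by rewrite divr_gt0.
have p1E : p - 1 = (r - 1)^-1 by rewrite /p; field; rewrite gt_eqF.
have p10 : 0 < p - 1 by rewrite p1E invr_gt0.
have pr : p^-1 + r^-1 = 1 by rewrite /p invf_div; field; rewrite !gt_eqF.
have r1p : (r - 1) * p = r by rewrite /p mulrC divfK ?gt_eqF.
have [M ME] : exists M, M = moment r f by exists (moment r f).
rewrite -ME in fmax.
have M_ge0 : 0 <= M by rewrite ME moment_ge0.
suff {h0 h01} MM2 : M ^+ 2 <= M2.
  have := fmax h0 h01; have := moment_ge0 r h0.
  move: (moment r h0) => m m0 mM; apply: le_trans MM2.
  by rewrite ler_pXn2r.
have [M_eq0|Mn0] := eqVneq M 0; first by rewrite M_eq0 expr0n.
have M0 : 0 < M by rewrite lt_neqAle eq_sym Mn0.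
pose g := synth f; have gB : cbounded_measurable g by exact: synth_bounded.
(* Up to a constant factor, [G] is the derivative of the [r]-th power of the modulus at [Sf]. Its
   modulus is [|Sf| ^ (r - 1)], and [(r - 1) p = r]. *)
pose G t : R[i] := (((normc (g t)) `^ (r - 2))%:C)%C * g t.
have GB : cbounded_measurable G.
  apply: cbounded_measurableM => //; apply: cbounded_measurable_real.
  apply: bounded_measurable_powR => //; first by move=> t; exact: normc_ge0.
  exact: bounded_measurable_normc.
have GE t : normc (G t) = normc (g t) `^ (r - 1).
  rewrite normcM normc_real ger0_norm ?powR_ge0// mulrC.
  have -> : r - 2 = (r - 1) - 1 by lra.
  by rewrite mulr_powRB1 ?normc_ge0.
pose u := coef G.
(* Young's inequality under the mean bounds the functional by [M / r + M / p = M]: the moment of [h]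
   is at most [M] by maximality, that of [f] equals [M]. *)
have ub h : lpsum p h <= 1 -> \sum_i complex.Re (h i * conjc (u i)) <= M.
  move=> h1; rewrite -Re_sum -synth_pairing// Re_cmean.
  have hrB : bounded_measurable (fun t => r^-1 * normc (synth h t) `^ r).
    exact/bounded_measurableZ/powR_synth_bounded/ltW.
  have frB : bounded_measurable (fun t => p^-1 * normc (synth f t) `^ r).
    exact/bounded_measurableZ/powR_synth_bounded/ltW.
  apply: (@le_trans _ _ (mean (fun t =>
      r^-1 * normc (synth h t) `^ r + p^-1 * normc (synth f t) `^ r))).
    apply: le_mean => //.
    - apply: (cbounded_measurableM _ _).1; first exact: synth_bounded.
      exact: cbounded_measurable_conj.
    - exact: bounded_measurableD.
    move=> t; rewrite (le_trans (Re_le_normc _))// normcM normc_conj GE.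
    rewrite (le_trans (conjugate_powR _ _ r0 p0 _)) ?normc_ge0 ?powR_ge0//.
      by rewrite addrC.
    by rewrite -powRrM r1p mulrC (mulrC _ p^-1).
  rewrite meanD// !meanZ//; try exact/powR_synth_bounded/ltW.
  rewrite -/(moment r h) -/(moment r f) -ME.
  apply: (@le_trans _ _ (r^-1 * M + p^-1 * M)).
    by rewrite lerD2r ler_pM2l ?invr_gt0//; exact: (fmax h).
  by rewrite -mulrDl addrC pr mul1r.
have fu : M <= \sum_i complex.Re (f i * conjc (u i)).
  rewrite -Re_sum -synth_pairing// Re_cmean.
  rewrite [leLHS](_ : M = mean (fun t => complex.Re (synth f t * conjc (G t))))//.
  rewrite ME; apply: eq_mean => t.
  rewrite /G rmorphM /= mulrCA mul_conjc conjc_real -rmorphM /=.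
  rewrite -powR_mulrn ?normc_ge0// -powRD ?subrK//.
  by rewrite implybE gt_eqF.
pose U := \sum_i normc (u i) `^ r.
have UM : U <= M `^ r.
  have U_ge0 : 0 <= U by rewrite sumr_ge0// => i _; exact: powR_ge0.
  have [->|Un0] := eqVneq U 0; first exact: powR_ge0.
  have U0 : 0 < U by rewrite lt_neqAle eq_sym Un0.
  (* The extremal vector of l^p duality: it has norm one and the functional takes the value
     [U ^ (1 / r)] at it. *)
  pose h i : R[i] := ((U `^ (- p^-1) * normc (u i) `^ (r - 2))%:C)%C * u i.
  have := ub h; rewrite /lpsum.
  have -> : \sum_i normc (h i) `^ p = 1.
    rewrite (eq_bigr (fun i => U^-1 * normc (u i) `^ r)) => [|i _].
      by rewrite -mulr_sumr mulVf.
    rewrite normcM normc_real ger0_norm; last by rewrite mulr_ge0 ?powR_ge0.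
    have -> : r - 2 = (r - 1) - 1 by lra.
    rewrite -mulrA (mulrC (_ `^ _) (normc _)) mulr_powRB1 ?normc_ge0//.
    rewrite powRM ?powR_ge0// -!powRrM r1p mulNr mulVf ?gt_eqF//.
    by rewrite powR_inv1// ltW.
  move=> /(_ (lexx _)).
  have -> : \sum_i complex.Re (h i * conjc (u i)) = U `^ r^-1.
    rewrite (eq_bigr (fun i => U `^ (- p^-1) * normc (u i) `^ r)) => [|i _].
      rewrite -mulr_sumr -/U -{2}(powRr1 U_ge0) -powRD; last first.
        by rewrite (negbTE Un0) implybT.
      by congr (_ `^ _); rewrite -pr addKr.
    rewrite /h -mulrA mul_conjc Re_realM [complex.Re _]/= -mulrA -powR_mulrn ?normc_ge0//.
    by rewrite -powRD ?subrK// implybE gt_eqF.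
  move=> UM; rewrite -(powRr1 U_ge0) -(mulVf (lt0r_neq0 r0)) powRrM.
  by rewrite ge0_ler_powR ?nnegrE ?powR_ge0 ?(ltW r0) ?(ltW M0).
pose v i := normc (u i) / M.
have v0 i : 0 <= v i by rewrite divr_ge0 ?normc_ge0// ltW.
have vr : \sum_i v i `^ r <= 1.
  rewrite (eq_bigr (fun i => normc (u i) `^ r * (M `^ r)^-1)) => [|i _].
    by rewrite -mulr_suml ler_pdivrMr ?powR_gt0// mul1r.
  by rewrite powRM ?normc_ge0 ?invr_ge0 ?(ltW M0)// -powR_inv1 ?(ltW M0)// -powRrM mulN1r powRN.
(* The defects in Young's inequality for [|f_j|] and [v_j] are nonnegative and add up to at most
   [1 / p + 1 / r - 1 = 0]. So each of them vanishes, and the equality case applies. *)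
have fv i : normc (f i) `^ p = v i `^ r.
  apply: conjugate_powR_eq; rewrite ?normc_ge0//.
  have young j : 0 <= normc (f j) `^ p / p + v j `^ r / r - normc (f j) * v j.
    by rewrite subr_ge0 conjugate_powR ?normc_ge0.
  rewrite -subr_le0; apply: le_trans
    (_ : \sum_j (normc (f j) `^ p / p + v j `^ r / r - normc (f j) * v j) <= 0).
    by rewrite (bigD1 i)//= lerDl sumr_ge0.
  rewrite sumrB big_split /= -!mulr_suml -/(lpsum p f).
  have : 1 <= \sum_j normc (f j) * v j.
    rewrite -(@ler_pM2l _ M)// mulr1 (le_trans fu)// mulr_sumr.
    apply: ler_sum => j _; rewrite (le_trans (Re_le_normc _))//.
    rewrite normcM normc_conj /v mulrCA ler_wpM2l ?normc_ge0//.
    by rewrite mulrC divfK.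
  have : lpsum p f / p <= p^-1 by rewrite ler_piMl ?invr_ge0 ?(ltW p0).
  have : (\sum_i v i `^ r) / r <= r^-1 by rewrite ler_piMl ?invr_ge0 ?(ltW r0).
  by move: pr; lra.
pose Q := lpsum (2 * (p - 1)) f.
have uQ : \sum_i normc (u i) ^+ 2 = M ^+ 2 * Q.
  rewrite /Q /lpsum mulr_sumr; apply: eq_bigr => i _.
  have -> : normc (u i) = M * v i by rewrite /v mulrC divfK.
  rewrite exprMn; congr (_ * _).
  have -> : v i = normc (f i) `^ (p - 1).
    have -> : p - 1 = p * r^-1 by rewrite /p; field; rewrite !gt_eqF.
    by rewrite powRrM fv -powRrM divff ?gt_eqF// powRr1.
  by rewrite -powR_mulrn ?powR_ge0// -powRrM mulrC.
have Q0 : 0 < Q.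
  rewrite lt_neqAle lpsum_ge0 andbT eq_sym; apply/eqP => Q0.
  suff : M = 0 by move/eqP; rewrite (negbTE Mn0).
  rewrite ME /moment (_ : (fun t => _) = fun=> 0) ?mean_cst//.
  apply: funext => t; rewrite /synth big1 ?normc0 ?powR0 ?gt_eqF// => i _.
  suff -> : f i = 0 by rewrite mul0r.
  apply: eq0_normc; apply: (@powR_eq0_eq0 _ _ (2 * (p - 1))).
  have /eqP := Q0; rewrite psumr_eq0 => [/allP/(_ i (mem_index_enum _))/eqP//|j _].
  exact: powR_ge0.
(* The chain is: [M ^ 2 Q] is the sum of [|u_i| ^ 2], at most the mean of [|G| ^ 2 = |Sf| ^ s],
   hence at most [M2] times the power of [lpsum (s / (s - 1)) f] that interpolation bounds by
   [Q]. *)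
rewrite -(@ler_pM2r _ Q)// -uQ (le_trans (bessel GB))//.
rewrite (_ : (fun t => _) = fun t => normc (synth f t) `^ s); last first.
  apply: funext => t; rewrite GE -powR_mulrn ?powR_ge0// -powRrM /s.
  by congr (_ `^ _); lra.
rewrite (le_trans (moment_homogeneous s1 hM2 f))// ler_wpM2l//.
exact: lpsum_interpolation.
Qed.

Lemma hausdorff_young r f : 2 <= r -> lpsum (r / (r - 1)) f <= 1 ->
  moment r f <= 1.
Proof.
move=> r2 f1; apply: (@expr2n_bounded_le1 _ _ #|I|%:R) => k.
have n0 : 0 <= #|I|%:R :> R by [].
(* Each step passes from [r] to [2 r - 2], again at least two, and takes a square root of the bound;
   hence the induction on [k] is uniform in [r]. *)
suff H : forall r, 2 <= r -> forall f, lpsum (r / (r - 1)) f <= 1 ->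
    moment r f <= #|I|%:R `^ (2 ^- k).
  apply: le_trans (_ : _ <= (#|I|%:R `^ (2 ^- k)) ^+ (2 ^ k)) _.
    by rewrite ler_pXn2r ?expn_gt0 ?nnegrE ?moment_ge0 ?powR_ge0// H.
  by rewrite -powR_mulrn ?powR_ge0// -powRrM natrX mulVf ?powRr1//.
elim: k {r f r2 f1} => [|k IH] r r2 f f1.
  by rewrite expr0 invr1 powRr1// moment_card//; lra.
have s2 : 2 <= 2 * r - 2 by lra.
have := moment_sqr_le r2 (powR_ge0 _ _) (IH _ s2) f1.
have -> : #|I|%:R `^ (2 ^- k) = (#|I|%:R `^ (2 ^- k.+1)) ^+ 2 :> R.
  rewrite -powR_mulrn ?powR_ge0// -powRrM; congr (_ `^ _).
  by rewrite exprSr invfM -mulrA mulVf ?mulr1.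
by rewrite ler_pXn2r ?nnegrE ?moment_ge0 ?powR_ge0.
Qed.

End hausdorff_young.

(** * Characters of a discrete group *)

Section partial_characters.
Context {R : realType} {X : zmodType}.
Implicit Types (G : set (X * R[i])) (x : X) (w z : R[i]).

(* The graph of a homomorphism from a subgroup of [X] to the circle. *)
Definition partial_character G :=
  [/\ G (0, 1),
      forall a b, G a -> G b -> G (a.1 - b.1, a.2 / b.2),
      forall a, G a -> normc a.2 = 1 &
      forall z, G (0, z) -> z = 1].

Lemma normc1_neq0 z : normc z = 1 -> z != 0.
Proof. by apply: contra_eq_neq => ->; rewrite normc0 eq_sym oner_neq0. Qed.

Lemma normcX z n : normc (z ^+ n) = normc z ^+ n.
Proof. by elim: n => [|n IH]; rewrite ?expr0 ?normc1// !exprS normcM IH. Qed.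

Lemma normc_exprz z (k : int) : normc z = 1 -> normc (z ^ k) = 1.
Proof.
by move=> z1; case: k => n; rewrite ?NegzE -?exprz_inv ?exprnN ?normcX ?normcV ?normcX z1 ?invr1 expr1n// ?invr1.
Qed.

Lemma partial_characterV G a : partial_character G -> G a -> G (- a.1, a.2^-1).
Proof. by case=> G0 GB _ _ /(GB _ _ G0); rewrite /= sub0r div1r. Qed.

Lemma partial_characterM G a b : partial_character G -> G a -> G b ->
  G (a.1 + b.1, a.2 * b.2).
Proof.
move=> Gch Ga /(partial_characterV Gch) Gb; case: Gch => _ /(_ _ _ Ga Gb) + _ _.
by rewrite /= opprK invrK.
Qed.

Lemma partial_character_exprz G x z (k : int) : partial_character G ->
  G (x, z) -> G (x *~ k, z ^ k).
Proof.
move=> Gch Gxz.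
have Gn n : G (x *~ n%:Z, z ^ n%:Z).
  elim: n => [|n IH]; first by case: Gch.
  rewrite -addn1 PoszD mulrzDr mulr1z -exprnP exprD expr1 exprnP.
  exact: (partial_characterM Gch IH Gxz).
case: k => n; first exact: Gn.
rewrite NegzE mulrNz -invr_expz.
exact: (partial_characterV Gch (Gn n.+1)).
Qed.

Lemma partial_character_inj G x z w : partial_character G ->
  G (x, z) -> G (x, w) -> z = w.
Proof.
case=> _ GB G1 G0 Gz Gw.
have := GB _ _ Gz Gw; rewrite /= subrr => /G0.
by move=> /divr1_eq.
Qed.

(** The extension to the subgroup generated by the domain of [G] and [x], with value [w] at [x]. *)
Definition extend_graph G x w : set (X * R[i]) :=
  [set a | exists k : int, G (a.1 - x *~ k, a.2 / w ^ k)].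

(** Agreement of [w ^ k] with [G] at those multiples of [x] that already lie in the domain makes the
    extension single-valued at zero. *)
Lemma partial_character_extend G x w : partial_character G -> normc w = 1 ->
  (forall (k : int) z, G (x *~ k, z) -> z = w ^ k) ->
  partial_character (extend_graph G x w).
Proof.
move=> Gch w1 Gw; have w0 := normc1_neq0 w1.
case: (Gch) => G0 GB G1 G00; split.
- by exists 0; rewrite /= mulr0z subr0 expr0z divr1.
- move=> a b [k Ga] [l Gb]; exists (k - l) => /=.
  rewrite mulrzBr expfzDr// -invr_expz.
  have := GB _ _ Ga Gb; rewrite /=.
  have -> : a.1 - x *~ k - (b.1 - x *~ l) = a.1 - b.1 - (x *~ k - x *~ l).
    by rewrite !opprB addrACA [RHS]addrACA [- b.1 + _]addrC.
  have -> // : a.2 / w ^ k / (b.2 / w ^ l) = a.2 / b.2 / (w ^ k / w ^ l).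
  by rewrite !invfM !invrK mulrACA.
- move=> a [k /G1] /=; rewrite normcM normcV (normc_exprz _ w1) invr1 mulr1.
  exact.
- move=> z [k] /=; rewrite sub0r => /(partial_characterV Gch) /=.
  rewrite opprK => /Gw zE.
  have := congr1 (fun y => y^-1 * w ^ k) zE.
  by rewrite invrK divfK ?expfz_neq0// mulVf ?expfz_neq0.
Qed.

Lemma extend_graph_sub G x w : G `<=` extend_graph G x w.
Proof. by move=> [a z] Ga; exists 0; rewrite /= mulr0z subr0 expr0z divr1. Qed.

Lemma extend_graph_new G x w : partial_character G -> normc w = 1 ->
  extend_graph G x w (x, w).
Proof.
move=> [G0 _ _ _] /normc1_neq0 w0.
by exists 1; rewrite /= mulr1z subrr expr1z divff.
Qed.

(** If [z] is not one, any root will do. If [z] is one, a root of [1 + w + ... + w ^ (n - 1)] is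
    taken; it is not one, because the value of this polynomial there is [n]. *)
Lemma root_neq1 n z : (1 < n)%N -> exists2 w : R[i], w ^+ n = z & w != 1.
Proof.
move=> n1; have n0 : (0 < n)%N by exact: ltnW.
have [z1|zn1] := eqVneq z 1.
  have /closed_rootP[w] : size (\poly_(i < n) (1 : R[i])) != 1.
    by rewrite size_poly_eq ?oner_neq0// gtn_eqF.
  rewrite /root horner_poly => /eqP w0; exists w.
    apply/eqP; rewrite z1 -subr_eq0 subrX1.
    by move: w0; under eq_bigr do rewrite mul1r; move=> ->; rewrite mulr0.
  apply/negP => /eqP w1; move/eqP: w0; rewrite w1.
  under eq_bigr do rewrite expr1n mulr1.
  by rewrite sumr_const card_ord pnatr_eq0 gtn_eqF.
have /closed_rootP[w] : size ('X^n - z%:P : {poly R[i]}) != 1.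
  by rewrite size_XnsubC// eqSS gtn_eqF.
rewrite rootE !hornerE subr_eq0 => /eqP wz; exists w => //.
by apply: contra_neq zn1 => w1; rewrite -wz w1 expr1n.
Qed.

(** If no positive multiple of [x] lies in the domain, [-1] is admissible. Otherwise let [n] be the
    least positive integer with [n x] in the domain; it exceeds one, so the value at [n x] has an
    [n]-th root other than one. By division with remainder, the multiples of [x] in the domain are
    exactly those of [n x]. *)
Lemma partial_character_value G x : partial_character G ->
  (forall z, ~ G (x, z)) ->
  exists w, [/\ normc w = 1, w != 1 &
                forall (k : int) z, G (x *~ k, z) -> z = w ^ k].
Proof.
move=> Gch xG; case: (Gch) => G0 GB G1 G00.
pose P n := `[< (0 < n)%N /\ exists z, G (x *+ n, z) >].
have [exP|nP] := pselect (exists n, P n); last first.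
  exists (-1); split.
  - by rewrite normcN normc1.
  - by rewrite -subr_eq0 -opprD oppr_eq0 (_ : 1 + 1 = 2%:R) ?pnatr_eq0.
  move=> [[|n]|n] z Gz.
  - by rewrite expr0z; apply: G00; rewrite mulr0z in Gz.
  - by exfalso; apply: nP; exists n.+1; apply/asboolP; split => //; exists z.
  - exfalso; apply: nP; exists n.+1; apply/asboolP; split => //; exists z^-1.
    by have := partial_characterV Gch Gz; rewrite /= NegzE mulrNz opprK.
case: (ex_minnP exP) => n /asboolP[n0 [y Gy]] nmin.
have n1 : (1 < n)%N.
  rewrite ltn_neqAle n0 andbT; apply/eqP => n1.
  by apply: (xG y); rewrite -n1 mulr1n in Gy.
have [w wy w1] := root_neq1 y n1.
have nw : normc w = 1.
  have := G1 _ Gy; rewrite /= -wy normcX => /eqP.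
  by rewrite pexpr_eq1 ?normc_ge0// => /eqP.
exists w; split=> // k z Gz.
have nz : n%:Z != 0 by rewrite gt_eqF// ltz_nat.
have kE := divz_eq k n%:Z.
have Gq := partial_character_exprz (k %/ n%:Z)%Z Gch Gy.
have := GB _ _ Gz Gq; rewrite /= pmulrn -mulrzA -mulrzBr.
have -> : k - n%:Z * (k %/ n%:Z)%Z = (k %% n%:Z)%Z by rewrite {1}kE mulrC addrC addKr.
have : (k %% n%:Z)%Z < n%:Z by rewrite (lt_le_trans (ltz_mod _ _)).
have : 0 <= (k %% n%:Z)%Z by exact: modz_ge0.
move: kE; case: (k %% n%:Z)%Z => // m kE _ mn Gm.
have m0 : m = 0%N.
  apply/eqP; rewrite -leqn0 leqNgt; apply/negP => m0.
  have : P m by apply/asboolP; split => //; exists (z / y ^ (k %/ n%:Z)%Z).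
  by move=> /nmin; rewrite leqNgt -ltz_nat mn.
move: Gm; rewrite m0 mulr0z => /G00 /divr1_eq ->.
by rewrite [in RHS]kE m0 addr0 -wy exprnP exprz_exp mulrC.
Qed.

Lemma exists_character_neq1 x : x != 0 -> exists eta : character R X, eta x != 1.
Proof.
move=> x0; pose G0 : set (X * R[i]) := [set (0, 1)].
have G0ch : partial_character G0.
  split=> //.
  - by move=> _ _ -> ->; rewrite /= subrr divr1.
  - by move=> _ ->; rewrite normc1.
  - by move=> z [].
have [|w [w1 wn1 wk]] := partial_character_value G0ch (x := x).
  by move=> z [] /eqP; rewrite (negbTE x0).
pose G1 := extend_graph G0 x w.
have G1ch : partial_character G1 by exact: partial_character_extend.
have G1x : G1 (x, w) by exact: extend_graph_new.
(* Zorn's lemma is applied to sets whose union with [G1] is a partial character. The empty chain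
   then has a bound too, and the maximal element respects the value [w] at [x]. *)
have [A [Ach Amax]] :
    exists A, partial_character (A `|` G1) /\
      forall B, A `<` B -> ~ partial_character (B `|` G1).
  apply: (@Zorn_bigcup _ [set A | partial_character (A `|` G1)]) => F FP Ftot.
  have memF a : (\bigcup_(B in F) B `|` G1) a ->
      G1 a \/ exists2 B, F B & (B `|` G1) a.
    by move=> [[B FB Ba]|?]; [right; exists B => //; left|left].
  have inF B a : F B -> (B `|` G1) a -> (\bigcup_(B in F) B `|` G1) a.
    by move=> FB [Ba|?]; [left; exists B|right].
  have [_ G1B G11 G10] := G1ch; split.
  - by right; case: G1ch.
  - move=> a b /memF[Ga|[B FB Ba]] /memF[Gb|[C FC Cb]].
    + by right; exact: G1B.
    + by apply: (inF _ _ FC); have [_ + _ _] := FP _ FC; apply => //; right.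
    + by apply: (inF _ _ FB); have [_ + _ _] := FP _ FB; apply => //; right.
    + have [BC|CB] := Ftot _ _ FB FC.
        apply: (inF _ _ FC); have [_ + _ _] := FP _ FC; apply => //.
        by case: Ba => [/BC|]; [left|right].
      apply: (inF _ _ FB); have [_ + _ _] := FP _ FB; apply => //.
      by case: Cb => [/CB|]; [left|right].
  - by move=> a /memF[/G11//|[B FB Ba]]; have [_ _ + _] := FP _ FB; apply.
  - by move=> z /memF[/G10//|[B FB Bz]]; have [_ _ _ +] := FP _ FB; apply.
set M := A `|` G1 in Ach.
have Mmax B : partial_character B -> M `<=` B -> B `<=` M.
  move=> Bch MB; apply/(subset_trans _ (@subsetUl _ A G1)).
  apply: contrapT => BA; apply: (Amax B).
    by split => //; exact: subset_trans (@subsetUl _ A G1) MB.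
  by rewrite setUidl//; exact: subset_trans (@subsetUr _ A G1) MB.
(* A point outside the domain would permit a proper extension. *)
have Mtot y : exists z, M (y, z).
  apply: contrapT => /forallNP yM.
  have [v [v1 _ vk]] := partial_character_value Ach yM.
  apply: (yM v); apply: (Mmax (extend_graph M y v)).
  - exact: partial_character_extend.
  - exact: extend_graph_sub.
  - exact: extend_graph_new.
pose h y := sval (cid (Mtot y)).
have hM y : M (y, h y) by exact: svalP (cid (Mtot y)).
have hch : is_character h.
  split=> [a b|a]; last by have [_ _ /(_ _ (hM a))] := Ach.
  apply: (partial_character_inj Ach (hM _)).
  exact: (partial_characterM Ach (hM a) (hM b)).
exists (Character hch) => /=.
suff -> : h x = w by [].
by apply: (partial_character_inj Ach (hM _)); right.
Qed.

End partial_characters.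

(** * The dual group: measurability, invariance and orthogonality of characters *)

Section dual_group.
Context {R : realType} {X : zmodType}.
Implicit Types (g eta : character R X) (x y : X).

Lemma character_ext g eta : chr g =1 chr eta -> g = eta.
Proof.
case: g eta => g gch [h hch] /= gh; have {}gh : g = h by apply: funext.
by subst h; congr Character; exact: Prop_irrelevance.
Qed.

Lemma normc_chr g x : normc (g x) = 1.
Proof. by have [] := chr_is_character g. Qed.

Lemma chrD g x y : g (x + y) = g x * g y.
Proof. by have [] := chr_is_character g. Qed.

Lemma chr0 g : g 0 = 1.
Proof.
apply: (mulfI (normc1_neq0 (normc_chr g 0))).
by rewrite mulr1 -chrD addr0.
Qed.

Lemma chrN g x : g (- x) = conjc (g x).
Proof.
apply: (mulfI (normc1_neq0 (normc_chr g x))).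
by rewrite -chrD subrr chr0 mul_conjc normc_chr expr1n.
Qed.

Lemma chrB g x y : g (x - y) = g x * conjc (g y).
Proof. by rewrite chrD chrN. Qed.

Fact character_mul_subproof eta g : is_character (fun x => eta x * g x).
Proof.
split=> [x y|x]; first by rewrite !chrD mulrACA.
by rewrite normcM !normc_chr mulr1.
Qed.

Definition character_mul eta g : character R X :=
  Character (character_mul_subproof eta g).

Fact character_conj_subproof eta : is_character (fun x => conjc (eta x)).
Proof.
split=> [x y|x]; first by rewrite chrD rmorphM.
by rewrite normc_conj normc_chr.
Qed.

Definition character_conj eta : character R X :=
  Character (character_conj_subproof eta).

Lemma measurable_dualP d (T : measurableType d) (f : T -> dual R X) :
  (forall x, measurable_fun [set: T] (fun t => complex.Re (chr (f t) x))) ->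
  (forall x, measurable_fun [set: T] (fun t => complex.Im (chr (f t) x))) ->
  measurable_fun [set: T] f.
Proof.
move=> fRe fIm; apply: (@measurability _ _ T (dual R X) setT f (@eval_sets R X)) => // _ [_ [x [B [mB [->|->]]]] <-].
  by rewrite setTI; have := fRe x measurableT _ mB; rewrite setTI.
by rewrite setTI; have := fIm x measurableT _ mB; rewrite setTI.
Qed.

Lemma measurable_chr_Re x :
  measurable_fun [set: dual R X] (fun g : dual R X => complex.Re (chr g x)).
Proof.
move=> _ B mB; rewrite setTI; apply: sub_sigma_algebra.
by exists x, B; split=> //; left.
Qed.

Lemma measurable_chr_Im x :
  measurable_fun [set: dual R X] (fun g : dual R X => complex.Im (chr g x)).
Proof.
move=> _ B mB; rewrite setTI; apply: sub_sigma_algebra.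
by exists x, B; split=> //; right.
Qed.

Lemma chr_bounded x : cbounded_measurable (fun g : dual R X => chr g x).
Proof.
by split; split; [exact: measurable_chr_Re| |exact: measurable_chr_Im|];
  exists 1 => g; rewrite -(normc_chr g x) -(@ler_pXn2r _ 2)//
    ?nnegrE ?normc_ge0// sqr_normcE real_normK ?num_real// ?lerDl ?lerDr sqr_ge0.
Qed.

Lemma measurable_character_mul eta :
  measurable_fun [set: dual R X] (character_mul eta : dual R X -> dual R X).
Proof.
have etaB x : cbounded_measurable (fun g : dual R X => eta x * chr g x).
  apply: cbounded_measurableM; last exact: chr_bounded.
  exact: cbounded_measurable_cst.
by apply: measurable_dualP => x; [case: (etaB x) => -[]|case: (etaB x) => _ []].
Qed.

Section haar.
Variables (c : {posnum R}) (mu : {measure set (dual R X) -> \bar R}).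
Hypothesis haar : dual_haar c mu.

Lemma dual_haarT : mu [set: dual R X] = (c%:num^-1)%:E.
Proof. by case: haar. Qed.

(** The preimage under multiplication by [eta] is the translate by the conjugate character, the
    inverse of [eta]. *)
Lemma dual_haar_preimage eta (A : set (dual R X)) : measurable A ->
  mu ((character_mul eta : dual R X -> dual R X) @^-1` A) = mu A.
Proof.
move=> mA; rewrite -(haar.2 (character_conj eta) A mA); congr (mu _).
have etaK x : conjc (eta x) * eta x = 1.
  by rewrite mulrC mul_conjc normc_chr expr1n.
apply/seteqP; split=> [g Ag|g [g' Ag' gE]] /=.
  by exists (character_mul eta g) => // x; rewrite /= mulrA etaK mul1r.
rewrite (_ : character_mul eta g = g')//; apply: character_ext => x /=.
by rewrite gE /= mulrA (mulrC (eta x)) etaK mul1r.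
Qed.

Lemma mean_translate eta (h : dual R X -> R) : bounded_measurable h ->
  mean mu c (fun g => h (character_mul eta g)) = mean mu c h.
Proof.
move=> hB; have [mh [M hM]] := hB.
have mtau := measurable_character_mul eta.
have hetaB : bounded_measurable (fun g : dual R X => h (character_mul eta g)).
  split; first exact: (measurableT_comp mh mtau).
  by exists M => g.
rewrite /mean /Rintegral; congr (_ * fine _).
pose tau : dual R X -> dual R X := character_mul eta.
transitivity (\int[pushforward mu tau]_g (h g)%:E)%E.
  rewrite (@integral_pushforward _ _ _ _ _ tau mtau mu setT (EFin \o h))//.
  - exact/measurable_EFinP.
  - exact: (bounded_measurable_integrable dual_haarT hetaB).
apply: eq_measure_integral => A mA _.
exact: dual_haar_preimage.
Qed.

(** Translation by [eta] multiplies the mean of the evaluation at [x] by [eta x] and also leaves it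
    unchanged; if [eta x] is not one, the mean vanishes. *)
Lemma cmean_chr x : cmean mu c (fun g : dual R X => chr g x) = (x == 0)%:R.
Proof.
have [->|x0] := eqVneq x 0.
  under eq_cmean do rewrite chr0.
  by congr Complex; exact: (mean_cst dual_haarT).
have [eta etax] := exists_character_neq1 (R := R) x0.
set z := cmean _ _ _.
have zE : eta x * z = z.
  rewrite /z -(cmeanZ dual_haarT); last exact: chr_bounded.
  have [Re_bounded Im_bounded] := chr_bounded x.
  congr Complex.
    exact: (mean_translate eta Re_bounded).
  exact: (mean_translate eta Im_bounded).
apply/eqP; have /eqP := zE; rewrite -{2}(mul1r z) -subr_eq0 -mulrBl mulf_eq0.
by rewrite subr_eq0 (negbTE etax).
Qed.

Lemma cmean_chr_conj x y :
  cmean mu c (fun g : dual R X => conjc (chr g x) * conjc (conjc (chr g y))) =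
  (x == y)%:R.
Proof.
under eq_cmean => g do rewrite conjcK mulrC -chrB.
by rewrite cmean_chr subr_eq0 eq_sym.
Qed.

End haar.
End dual_group.

(** * The Fourier transform *)

Section Lnorm_real.
Context d {T : measurableType d} {R : realType}.
Variable mu : {measure set T -> \bar R}.
Implicit Types (g h : T -> R) (q A : R).

Lemma Lnorm_powR q g : (forall t, 0 <= g t) ->
  Lnorm mu q%:E (fun t => (g t)%:E) =
  ((\int[mu]_t (g t `^ q)%:E) `^ q^-1)%E.
Proof.
move=> g0; rewrite unlock.
rewrite (@eq_integral _ _ _ mu _ (fun t => (g t `^ q)%:E)) => [//|t _].
by rewrite gee0_abs ?lee_fin.
Qed.

Lemma integral_powR_ge0 q g : (0 <= \int[mu]_t (g t `^ q)%:E)%E.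
Proof. by apply: integral_ge0 => t _; rewrite lee_fin powR_ge0. Qed.

Lemma Lnorm_le_powR q g A : 0 < q -> (forall t, 0 <= g t) ->
  (\int[mu]_t (g t `^ q)%:E <= A%:E)%E ->
  (Lnorm mu q%:E (fun t => (g t)%:E) <= (A `^ q^-1)%:E)%E.
Proof.
move=> q0 g0 gA; rewrite Lnorm_powR// -poweR_EFin.
have I0 := integral_powR_ge0 q g.
apply: gt0_ler_poweR => //; rewrite ?invr_ge0 ?(ltW q0)// in_itv/= leey andbT//.
exact: le_trans gA.
Qed.

Lemma Lnorm_ge_powR q g A : 0 < q -> (forall t, 0 <= g t) -> 0 <= A ->
  (A%:E <= \int[mu]_t (g t `^ q)%:E)%E ->
  ((A `^ q^-1)%:E <= Lnorm mu q%:E (fun t => (g t)%:E))%E.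
Proof.
move=> q0 g0 A0 gA; rewrite Lnorm_powR// -poweR_EFin.
have I0 := integral_powR_ge0 q g.
by apply: gt0_ler_poweR => //; rewrite ?invr_ge0 ?(ltW q0)// in_itv/= leey andbT.
Qed.

Lemma Lnorm2_lt g A : 0 < A -> (forall t, 0 <= g t) ->
  (Lnorm mu 2%:E (fun t => (g t)%:E) < A%:E)%E ->
  (\int[mu]_t (g t ^+ 2)%:E <= (A ^+ 2)%:E)%E.
Proof.
move=> A0 g0 /ltW gA; have n2 : (2 : R) != 0 by [].
rewrite -powR_mulrn ?(ltW A0)// -poweR_EFin.
rewrite (_ : (\int[mu]_t _)%E = (\int[mu]_t (`|(g t)%:E| `^ 2))%E); last first.
  apply: eq_integral => t _; rewrite gee0_abs ?lee_fin// poweR_EFin.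
  by rewrite powR_mulrn.
rewrite -(poweR_Lnorm _ _ n2).
by apply: gt0_ler_poweR => //; rewrite in_itv/= leey andbT ?lee_fin ?(ltW A0)// Lnorm_ge0.
Qed.

End Lnorm_real.

(** * Passage of bounds to L^2-limits *)

Section L2_limits.
Context d {T : measurableType d} {R : realType}.
Variables (mu : {measure set T -> \bar R}) (c : {posnum R}).
Hypothesis muT : mu [set: T] = (c%:num^-1)%:E.
Local Notation mean := (mean mu c).
Variable u : T -> R[i].
Hypothesis uRe : measurable_fun [set: T] (fun t => complex.Re (u t)).
Hypothesis uIm : measurable_fun [set: T] (fun t => complex.Im (u t)).

Lemma bounded_measurable_minr (g : T -> R) K : measurable_fun [set: T] g ->
  (forall t, 0 <= g t) -> 0 <= K -> bounded_measurable (fun t => Num.min (g t) K).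
Proof.
move=> mg g0 K0; split; first exact: measurable_minr.
by exists K => t; rewrite ger0_norm ?le_min ?g0// ge_min lexx orbT.
Qed.

Lemma measurable_dist (s : T -> R[i]) : cbounded_measurable s ->
  measurable_fun [set: T] (fun t => normc (u t - s t)).
Proof.
move=> [[s1 _] [s2 _]]; apply: measurable_normc.
  by under eq_fun do rewrite ReD ReN; exact: measurable_funB.
by under eq_fun do rewrite ImD ImN; exact: measurable_funB.
Qed.

(** The limit [u] need not be bounded; truncating the distance at [K] makes [mean] applicable to
    it. *)
Lemma mean_truncated_dist (s : T -> R[i]) K e : cbounded_measurable s ->
  0 <= K -> 0 < e -> (Lnorm mu 2%:E (fun t => (normc (u t - s t))%:E) < e%:E)%E ->
  mean (fun t => Num.min (normc (u t - s t)) K ^+ 2) <= c%:num * e ^+ 2.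
Proof.
move=> sB K0 e0 /(Lnorm2_lt e0 (fun _ => normc_ge0 _)) le_e.
have mB : bounded_measurable (fun t => Num.min (normc (u t - s t)) K).
  by apply: bounded_measurable_minr => //; [exact: measurable_dist|move=> t; exact: normc_ge0].
have m2B : bounded_measurable (fun t => Num.min (normc (u t - s t)) K ^+ 2).
  by under eq_fun do rewrite expr2; exact: bounded_measurableM.
rewrite mulrC -ler_pdivrMr// -lee_fin -(integral_mean muT)//.
apply: le_trans le_e; apply: ge0_le_integral => //.
- by move=> t _; rewrite lee_fin sqr_ge0.
- by apply/measurable_EFinP; case: m2B.
- by apply/measurable_EFinP/measurable_funX/measurable_dist.
- move=> t _; rewrite lee_fin ler_pXn2r ?nnegrE ?le_min ?normc_ge0//.
  by rewrite ge_min lexx.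
Qed.

(** On the interval from [0] to [K] the [r]-th power is Lipschitz with constant [L], and truncations
    of [|u|] and [|s|] differ by at most the truncated distance [D]. The quadratic bound
    [D <= dl + D ^ 2 / dl] reduces the error to the L^2 distance. *)
Lemma L2_limit_truncated (A r K : R) : 1 <= r -> 0 < K ->
  (forall e, 0 < e -> exists s : T -> R[i], [/\ cbounded_measurable s,
     mean (fun t => normc (s t) `^ r) <= A &
     (Lnorm mu 2%:E (fun t => (normc (u t - s t))%:E) < e%:E)%E]) ->
  mean (fun t => Num.min (normc (u t)) K `^ r) <= A.
Proof.
move=> r1 K0 us; have r0 : 0 < r by exact: lt_le_trans r1.
pose L := r * K `^ (r - 1); have L0 : 0 < L by rewrite mulr_gt0// powR_gt0.
apply/ler_addgt0Pr => e e0.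
(* The two error terms each contribute at most [L dl = e / 2]; [e1] is chosen so that
   [c e1 ^ 2 = dl ^ 2]. *)
pose dl := e / (2 * L); have dl0 : 0 < dl by rewrite divr_gt0// mulr_gt0.
pose e1 := Num.sqrt (dl ^+ 2 / c%:num).
have e10 : 0 < e1 by rewrite sqrtr_gt0 divr_gt0// exprn_gt0.
have [s [sB sA sd]] := us _ e10.
have := mean_truncated_dist sB (ltW K0) e10 sd.
rewrite sqr_sqrtr ?divr_ge0 ?sqr_ge0// mulrC divfK ?gt_eqF// => dB.
pose D t := Num.min (normc (u t - s t)) K.
have DB : bounded_measurable D.
  by apply: bounded_measurable_minr; rewrite ?(ltW K0)//; [exact: measurable_dist|move=> t; exact: normc_ge0].
have D2B : bounded_measurable (fun t => D t ^+ 2).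
  by under eq_fun do rewrite expr2; exact: bounded_measurableM.
have srB : bounded_measurable (fun t => normc (s t) `^ r).
  apply: bounded_measurable_powR; rewrite ?(ltW r0)//; first by move=> t; exact: normc_ge0.
  exact: bounded_measurable_normc.
have minB : bounded_measurable (fun t => Num.min (normc (u t)) K `^ r).
  apply: bounded_measurable_powR; rewrite ?(ltW r0)//.
    by move=> t; rewrite le_min normc_ge0 ltW.
  by apply: bounded_measurable_minr; rewrite ?(ltW K0)//; [exact: measurable_normc|move=> t; exact: normc_ge0].
have LDB : bounded_measurable (fun t => L * dl + L / dl * D t ^+ 2).
  apply: bounded_measurableD; first exact: bounded_measurable_cst.
  exact: bounded_measurableZ.
apply: (@le_trans _ _ (mean (fun t =>
    normc (s t) `^ r + (L * dl + L / dl * D t ^+ 2)))).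
  apply: le_mean => //; first exact: bounded_measurableD.
  move=> t; pose b := Num.min (normc (s t)) K.
  have b0 : 0 <= b <= K by rewrite le_min normc_ge0 (ltW K0) ge_min lexx orbT.
  have a0 : 0 <= Num.min (normc (u t)) K <= K.
    by rewrite le_min normc_ge0 (ltW K0) ge_min lexx orbT.
  have abD : `|Num.min (normc (u t)) K - b| <= D t.
    have := ler_dist_normc (u t) (s t); rewrite /D /b.
    move: (normc_ge0 (u t)) (normc_ge0 (s t)) (normc (u t - s t)).
    move: (normc (u t)) (normc (s t)) => x y x0 y0 z; rewrite ler_norml => /andP[h1 h2].
    rewrite le_min !ler_norml.
    by have := K0; case: (leP x K) => xK; case: (leP y K) => yK K00;
      apply/andP; split; apply/andP; split; lra.
  have := powR_lipschitz a0 b0 r1; rewrite -/L => h.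
  have bs : b `^ r <= normc (s t) `^ r.
    rewrite ge0_ler_powR ?nnegrE ?(ltW r0) ?normc_ge0 ?ge_min ?lexx//.
    by case/andP: b0.
  have DAM : D t <= dl + dl^-1 * D t ^+ 2.
    have D0 : 0 <= D t by rewrite le_min normc_ge0 ltW.
    have [Ddl|dlD] := leP (D t) dl.
      by rewrite (le_trans Ddl)// lerDl mulr_ge0 ?invr_ge0 ?sqr_ge0// ltW.
    rewrite (@le_trans _ _ (dl^-1 * D t ^+ 2)) ?lerDr ?(ltW dl0)//.
    by rewrite ler_pdivlMl// expr2 ler_wpM2r// ltW.
  have LD : L * D t <= L * dl + L / dl * D t ^+ 2.
    by rewrite -mulrA -mulrDr ler_pM2l.
  have := ler_norm (Num.min (normc (u t)) K `^ r - b `^ r).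
  have : L * `|Num.min (normc (u t)) K - b| <= L * D t by rewrite ler_pM2l.
  move: h bs LD; lra.
rewrite !meanD//; try exact: bounded_measurable_cst; try exact: bounded_measurableZ.
rewrite (mean_cst muT) meanZ// lerD//.
have : L / dl * mean (fun t => D t ^+ 2) <= L / dl * dl ^+ 2.
  by rewrite ler_wpM2l// divr_ge0 ?(ltW L0)// ltW.
have -> : L / dl * dl ^+ 2 = L * dl by field; rewrite gt_eqF.
have -> : L * dl = e / 2 by rewrite /dl; field; rewrite gt_eqF.
lra.
Qed.

(** Monotone convergence as the truncation level grows; at each point the truncations are eventually
    constant. *)
Lemma L2_limit_integral (A r : R) : 1 <= r ->
  (forall e, 0 < e -> exists s : T -> R[i], [/\ cbounded_measurable s,
     mean (fun t => normc (s t) `^ r) <= A &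
     (Lnorm mu 2%:E (fun t => (normc (u t - s t))%:E) < e%:E)%E]) ->
  (\int[mu]_t (normc (u t) `^ r)%:E <= (A / c%:num)%:E)%E.
Proof.
move=> r1 us; have r0 : 0 < r by exact: lt_le_trans r1.
pose h n t := (Num.min (normc (u t)) n.+1%:R `^ r)%:E.
have hB n : bounded_measurable (fun t => Num.min (normc (u t)) n.+1%:R `^ r).
  apply: bounded_measurable_powR; rewrite ?(ltW r0)//.
    by move=> t; rewrite le_min normc_ge0 ler0n.
  by apply: bounded_measurable_minr => //; [exact: measurable_normc|move=> t; exact: normc_ge0].
have nd t : nondecreasing_seq (h ^~ t).
  move=> m n mn; rewrite lee_fin ge0_ler_powR ?nnegrE ?(ltW r0) ?le_min ?normc_ge0 ?ler0n//.
  by rewrite !ge_min lexx /= ler_nat ltnS mn orbT.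
have hlim t : h ^~ t @ \oo --> (normc (u t) `^ r)%:E.
  apply: cvg_near_cst; exists (Num.truncn (normc (u t))) => // n /= un.
  by rewrite /h min_l// (le_trans (ltW (truncnS_gt _)))// ler_nat.
rewrite (@eq_integral _ _ _ mu _ (fun t => limn (h ^~ t))); last first.
  by move=> t _; rewrite (cvg_lim _ (hlim t)).
rewrite monotone_convergence//; last 2 first.
- by move=> n; apply/measurable_EFinP; case: (hB n).
- by move=> n t _; rewrite lee_fin powR_ge0.
apply: lime_le.
  apply: ereal_nondecreasing_is_cvgn => m n mn; apply: ge0_le_integral => //.
  - by move=> t _; rewrite lee_fin powR_ge0.
  - by apply/measurable_EFinP; case: (hB m).
  - by apply/measurable_EFinP; case: (hB n).
  - by move=> t _; exact: nd.
apply: nearW => n; rewrite (integral_mean muT (hB n)) lee_fin ler_pM2r ?invr_gt0//.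
exact: L2_limit_truncated.
Qed.

(** The excess of [|u|] over [B], cut off at one, is dominated by the truncated distance to every
    approximant, so its square has mean zero. *)
Lemma L2_limit_ae (B : R) :
  (forall e, 0 < e -> exists s : T -> R[i], [/\ cbounded_measurable s,
     (forall t, normc (s t) <= B) &
     (Lnorm mu 2%:E (fun t => (normc (u t - s t))%:E) < e%:E)%E]) ->
  \forall t \ae mu, normc (u t) <= B.
Proof.
move=> us.
pose E t := Num.min (Num.max (normc (u t) - B) 0) 1.
have EB : bounded_measurable E.
  apply: bounded_measurable_minr => //; last by move=> t; rewrite le_max lexx orbT.
  apply: measurable_maxr => //.
  by apply: measurable_funB => //; exact: measurable_normc.
have E0 t : 0 <= E t by rewrite le_min le_max lexx orbT ler01.
have E2B : bounded_measurable (fun t => E t ^+ 2).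
  by under eq_fun do rewrite expr2; exact: bounded_measurableM.
have E2_0 : mean (fun t => E t ^+ 2) = 0.
  apply/eqP; rewrite eq_le mean_ge0 ?andbT => [|t]; last exact: sqr_ge0.
  apply/ler_addgt0Pr => e e0; rewrite add0r.
  pose e1 := Num.sqrt (e / c%:num).
  have e10 : 0 < e1 by rewrite sqrtr_gt0 divr_gt0.
  have [s [sB sb sd]] := us _ e10.
  have := mean_truncated_dist sB ler01 e10 sd.
  rewrite sqr_sqrtr ?divr_ge0 ?(ltW e0)// mulrC divfK ?gt_eqF//.
  apply: le_trans; apply: le_mean => //.
    have mB : bounded_measurable (fun t => Num.min (normc (u t - s t)) 1).
      by apply: bounded_measurable_minr => //; [exact: measurable_dist|move=> t; exact: normc_ge0].
    by under eq_fun do rewrite expr2; exact: bounded_measurableM.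
  move=> t; rewrite ler_pXn2r ?nnegrE ?E0//; last by rewrite le_min normc_ge0 ler01.
  rewrite le_min !ge_min lexx orbT andbT ge_max normc_ge0 andbT.
  have := ler_dist_normc (u t) (s t); rewrite ler_norml => /andP[_ h].
  by apply/orP; left; have := sb t; lra.
have : (\int[mu]_t `|(E t ^+ 2)%:E| = 0)%E.
  rewrite (@eq_integral _ _ _ mu _ (fun t => (E t ^+ 2)%:E)) => [|t _]; last first.
    by rewrite gee0_abs ?lee_fin ?sqr_ge0.
  by rewrite (integral_mean muT E2B) E2_0 mul0r.
move/(ae_eq_integral_abs mu measurableT).
have mE : measurable_fun [set: T] (fun t => (E t ^+ 2)%:E).
  by apply/measurable_EFinP; case: E2B.
move=> /(_ mE); apply: filterS => t /(_ I) /= /eqP.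
rewrite eqe sqrf_eq0 /E => /eqP Et.
rewrite leNgt; apply/negP => But.
have : 0 < Num.min (Num.max (normc (u t) - B) 0) 1.
  by rewrite lt_min ltr01 lt_max subr_gt0 But.
by rewrite Et ltxx.
Qed.

(** Hoelder's inequality on a finite measure, by integrating [(|u| / B) ^ q <= a (|u| / B) ^ r + (1
    - a)] with [a = q / r]. *)
Lemma integral_powR_le (B q r : R) : 0 < q -> q <= r -> 0 < B ->
  (\int[mu]_t (normc (u t) `^ r)%:E <= (B `^ r / c%:num)%:E)%E ->
  (\int[mu]_t (normc (u t) `^ q)%:E <= (B `^ q / c%:num)%:E)%E.
Proof.
move=> q0 qr B0 uB; have r0 : 0 < r by exact: lt_le_trans qr.
pose a := q / r; have a0 : 0 < a by rewrite divr_gt0.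
have a1 : a <= 1 by rewrite ler_pdivrMr// mul1r.
have mu_q x : measurable_fun [set: T] (fun t => (normc (u t) `^ x)%:E).
  by apply/measurable_EFinP/(measurableT_comp (measurable_powR _))/measurable_normc.
have k0 : 0 <= B `^ q * a / B `^ r by rewrite !mulr_ge0 ?invr_ge0 ?powR_ge0 ?(ltW a0) ?(ltW q0) ?(ltW r0).
have l0 : 0 <= B `^ q * (1 - a) by rewrite mulr_ge0 ?powR_ge0// subr_ge0.
apply: (@le_trans _ _ (\int[mu]_t (((B `^ q * a / B `^ r)%:E * (normc (u t) `^ r)%:E) +
    (B `^ q * (1 - a))%:E))%E).
  apply: ge0_le_integral => //.
  - by move=> t _; rewrite lee_fin powR_ge0.
  - by apply: emeasurable_funD => //; exact: measurable_funeM.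
  - move=> t _; rewrite -EFinM -EFinD lee_fin.
    have nt0 := normc_ge0 (u t).
    have := @weighted_AGM _ ((normc (u t) / B) `^ r) 1 a (powR_ge0 _ _) ler01.
    rewrite (ltW a0) a1 powR1 !mulr1 -powRrM => /(_ isT).
    have -> : r * a = q by rewrite /a mulrC divfK ?gt_eqF.
    rewrite !powRM ?invr_ge0 ?(ltW B0)// -![B^-1]powR_inv1 ?(ltW B0)// -!powRrM !mulN1r !powRN.
    rewrite ler_pdivrMr ?powR_gt0// => /le_trans; apply.
    by rewrite le_eqVlt; apply/orP; left; apply/eqP; ring.
rewrite ge0_integralD//; last 2 first.
- by move=> t _; rewrite -EFinM lee_fin mulr_ge0 ?powR_ge0.
- exact: measurable_funeM.
rewrite ge0_integralZl_EFin//; last by move=> t _; rewrite lee_fin powR_ge0.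
rewrite integral_cst// muT -EFinM.
apply: (@le_trans _ _ ((B `^ q * a / B `^ r)%:E * (B `^ r / c%:num)%:E +
    (B `^ q * (1 - a) / c%:num)%:E)%E).
  by rewrite leeD2r// lee_wpmul2l// lee_fin.
rewrite -EFinM -EFinD lee_fin le_eqVlt; apply/orP; left; apply/eqP.
by field; rewrite !gt_eqF ?powR_gt0.
Qed.

End L2_limits.

(** * Integration over the discrete group *)

Section discrete_haar.
Context {R : realType} {X : zmodType}.
Variable c : {posnum R}.
Implicit Types (f : X -> R[i]) (F : {fset X}).
Local Notation haarX := (haar_discr X c).

Lemma haar_discr_fset F : haarX [set` F] = (c%:num * #|` F|%:R)%:E.
Proof.
transitivity ((c%:num)%:E * @counting X R [set` F])%E => //.
rewrite /counting asboolT; last exact: finite_fset.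
by rewrite set_fsetK.
Qed.

Lemma haar_discr_sum_le F (g : X -> R) : (forall x, 0 <= g x) ->
  ((\sum_(x <- F) c%:num * g x)%:E <= \int[haarX]_x (g x)%:E)%E.
Proof.
move=> g0; pose h x (t : discr X) : \bar R := ((g x)%:E * (\1_[set x] t)%:E)%E.
have h0 x t : (0 <= h x t)%E by rewrite mule_ge0 ?lee_fin ?g0.
(* The finite sum is the integral of [g] restricted to [F], written as a combination of indicators
   of points. *)
apply: (@le_trans _ _ (\int[haarX]_t (\sum_(x <- F) h x t))%E); last first.
  apply: ge0_le_integral => //.
  - by move=> t _; exact: sume_ge0.
  - move=> t _; have [tF|tF] := boolP (t \in F).
      rewrite (big_fsetD1 t)//= [X in (_ + X)%E]big1_seq ?adde0 => [|x /andP[_ xF]].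
        by rewrite /h indicE mem_set// mule1.
      move: xF; rewrite !inE => /andP[xt _].
      by rewrite /h indicE memNset ?mule0// => tx; rewrite tx eqxx in xt.
    rewrite big1_seq ?lee_fin// => x /andP[_ xF].
    by rewrite /h indicE memNset ?mule0// => tx; rewrite tx xF in tF.
rewrite ge0_integral_sum//.
rewrite -sumEFin; apply: lee_sum => x _.
rewrite /h ge0_integralZl_EFin//.
rewrite integral_indic// setIT.
have -> : [set x] = [set` [fset x]%fset] by rewrite set_fset1.
by rewrite haar_discr_fset cardfs1 mulr1 -EFinM mulrC.
Qed.

Lemma normX_sum_le p f F : 0 < p -> normX c p%:E f = 1%E ->
  \sum_(x <- F) normc (f x) `^ p <= c%:num^-1.
Proof.
move=> p0 f1.
have I1 : (\int[haarX]_x (normc (f x) `^ p)%:E = 1)%E.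
  have pn0 : p != 0 by rewrite gt_eqF.
  have := poweR_Lnorm haarX (fun x : discr X => (normc (f x))%:E) pn0.
  rewrite -/(normX c p%:E f) f1 poweR1r => ->.
  apply: eq_integral => t _.
  by rewrite gee0_abs ?lee_fin ?normc_ge0.
have := haar_discr_sum_le F (fun x => powR_ge0 (normc (f x)) p).
by rewrite I1 lee_fin -mulr_sumr -ler_pdivlMl// mulr1.
Qed.

End discrete_haar.

(** * The upper bound for the Fourier transform *)

Section fourier_upper_bound.
Context {R : realType} {X : zmodType}.
Variables (c : {posnum R}) (mu : {measure set (dual R X) -> \bar R}).
Hypothesis haar : dual_haar c mu.
Implicit Types (f : X -> R[i]) (F : {fset X}) (p q r : R).
Local Notation mean := (mean mu c).
Let muT := dual_haarT haar.

Lemma partial_fourier_bounded f F : cbounded_measurable (partial_fourier c f F).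
Proof.
apply: cbounded_measurableM; first exact: cbounded_measurable_cst.
apply: cbounded_measurable_sum => x.
apply: cbounded_measurableM; first exact: cbounded_measurable_cst.
exact/cbounded_measurable_conj/chr_bounded.
Qed.

Lemma partial_fourier_synth f F (g : dual R X) : partial_fourier c f F g =
  ((c%:num)%:C)%C * synth (fun (i : F) (g : dual R X) => conjc (chr g (val i)))
    (fun i => f (val i)) g.
Proof. by rewrite /partial_fourier big_seq_fsetE. Qed.

Lemma conj_chr_bounded x :
  cbounded_measurable (fun g : dual R X => conjc (chr g x)).
Proof. exact/cbounded_measurable_conj/chr_bounded. Qed.

Lemma conj_chr_orthonormal F (i j : F) :
  cmean mu c (fun g : dual R X =>
    conjc (chr g (val i)) * conjc (conjc (chr g (val j)))) = (i == j)%:R.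
Proof. by rewrite (cmean_chr_conj haar) (inj_eq val_inj). Qed.

(** The finite inequality for the conjugate characters, applied to [f / L], which lies in the unit
    ball. *)
Lemma partial_fourier_hausdorff_young f F r (L : R) : 2 <= r -> 0 < L ->
  \sum_(x <- F) normc (f x) `^ (r / (r - 1)) <= L `^ (r / (r - 1)) ->
  mean (fun g => normc (partial_fourier c f F g) `^ r) <= (c%:num * L) `^ r.
Proof.
move=> r2 L0 fL; have r0 : 0 <= r by lra.
pose phi (i : F) (g : dual R X) := conjc (chr g (val i)).
have phiB i : cbounded_measurable (phi i) by exact: conj_chr_bounded.
have phi1 i g : normc (phi i g) <= 1 by rewrite normc_conj normc_chr.
have := @hausdorff_young _ _ _ mu c muT F phi phiB phi1 (@conj_chr_orthonormal F)
  r (fun i => ((L^-1)%:C)%C * f (val i)) r2.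
rewrite lpsumZ ?invr_ge0 ?(ltW L0)//.
rewrite momentZ ?invr_ge0 ?(ltW L0)//.
rewrite /lpsum -(big_seq_fsetE _ _ xpredT (fun x => normc (f x) `^ (r / (r - 1)))) /=.
have LV x : L^-1 `^ x = (L `^ x)^-1.
  by rewrite -powR_inv1 ?(ltW L0)// -powRrM mulN1r powRN.
rewrite !LV !ler_pdivrMl ?powR_gt0// !mulr1 => /(_ fL) h.
rewrite (_ : (fun g => _) = fun g => c%:num `^ r *
    normc (synth phi (fun i => f (val i)) g) `^ r); last first.
  apply: funext => g; rewrite partial_fourier_synth normcM normc_real.
  by rewrite ger0_norm// powRM// normc_ge0.
rewrite meanZ//; last exact: powR_synth_bounded.
by rewrite powRM ?(ltW L0)// ler_pM2l ?powR_gt0.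
Qed.

(** For [p <= 1] the l^1 norm is at most [L]: each ratio [|f x| / L] is at most one, hence at most
    its own [p]-th power. *)
Lemma partial_fourier_le f F p (L : R) (g : dual R X) : 0 < p -> p <= 1 -> 0 < L ->
  \sum_(x <- F) normc (f x) `^ p <= L `^ p ->
  normc (partial_fourier c f F g) <= c%:num * L.
Proof.
move=> p0 p1 L0 fL.
rewrite normcM normc_real ger0_norm// ler_pM2l//.
rewrite (le_trans (normc_sum _ _))//.
under eq_bigr do rewrite normcM normc_conj normc_chr mulr1.
have fL1 x : x \in F -> normc (f x) <= L.
  move=> xF; rewrite leNgt; apply/negP => Lfx.
  have : normc (f x) `^ p <= L `^ p.
    rewrite (le_trans _ fL)// (big_fsetD1 x)//= lerDl sumr_ge0// => y _.
    exact: powR_ge0.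
  by rewrite leNgt gt0_ltr_powR// nnegrE ?normc_ge0 ?(ltW L0).
have fx x : x \in F -> normc (f x) <= L * (normc (f x) `^ p * (L `^ p)^-1).
  move=> xF; have [f0|f0] := eqVneq (normc (f x)) 0.
    by rewrite f0 !mulr_ge0 ?invr_ge0 ?powR_ge0 ?(ltW L0).
  have {}f0 : 0 < normc (f x) by rewrite lt_neqAle eq_sym f0 normc_ge0.
  rewrite -ler_pdivrMl// mulrC.
  have : 0 < normc (f x) / L <= 1.
    by rewrite divr_gt0//= ler_pdivrMr// mul1r fL1.
  move=> /ger1_powR/(_ p1) /le_trans; apply.
  rewrite powRM ?normc_ge0 ?invr_ge0 ?(ltW L0)//.
  by rewrite -(powR_inv1 (ltW L0)) -powRrM mulN1r powRN.
rewrite big_seq (le_trans (ler_sum _ fx))// -big_seq -mulr_sumr -mulr_suml.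
by rewrite ler_piMr ?(ltW L0)// ler_pdivrMr ?powR_gt0// mul1r.
Qed.

Lemma fourier_upper_bound p (q : \bar R) f fh : 0 < p -> p <= 2 -> (0 < q)%E ->
  1 <= p^-1 + recip q ->
  normX c p%:E f = 1%E -> is_fourier c mu f fh ->
  (Lnorm mu q (fun g => (normc (fh g))%:E) <=
    (c%:num `^ (1 - p^-1 - recip q))%:E)%E.
Proof.
move=> p0 p2 q0 pq f1 [fhRe [fhIm fhL2]].
have cn0 : 0 < c%:num by [].
(* Each point has mass [c], so norm one means that the plain l^p norm is at most [c ^ (- 1 / p)]. *)
pose L := c%:num `^ (- p^-1); have L0 : 0 < L by rewrite powR_gt0.
have Lp : L `^ p = c%:num^-1.
  by rewrite /L -powRrM mulNr mulVf ?gt_eqF// powR_inv1.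
have fL F : \sum_(x <- F) normc (f x) `^ p <= L `^ p.
  by rewrite Lp; exact: normX_sum_le.
pose B := c%:num * L; have B0 : 0 < B by rewrite mulr_gt0.
have BE : B = c%:num `^ (1 - p^-1).
  rewrite powRD; last by rewrite (gt_eqF cn0) implybT.
  by rewrite powRr1.
have approx e : 0 < e -> exists F,
    (Lnorm mu 2%:E (fun g => (normc (fh g - partial_fourier c f F g))%:E) < e%:E)%E.
  by move=> /fhL2[F0 FE]; exists F0; apply: FE.
(* For finite exponents: a bound on the [r]-th moments of the partial transforms passes to the
   limit, and is then lowered from [r] to [q']. *)
have realq (q' r : R) : 0 < q' -> q' <= r -> 2 <= r ->
    (forall F, mean (fun g => normc (partial_fourier c f F g) `^ r) <= B `^ r) ->
    (Lnorm mu q'%:E (fun g => (normc (fh g))%:E) <=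
      (c%:num `^ (1 - p^-1 - recip q'%:E))%:E)%E.
  move=> q'0 q'r r2 HB.
  have le_r : (\int[mu]_g (normc (fh g) `^ r)%:E <= (B `^ r / c%:num)%:E)%E.
    apply: L2_limit_integral => //; first by lra.
    move=> e /approx[F FE]; exists (partial_fourier c f F); split => //.
    exact: partial_fourier_bounded.
  have := integral_powR_le muT fhRe fhIm q'0 q'r B0 le_r.
  move=> /(Lnorm_le_powR q'0 (fun=> normc_ge0 _)) /le_trans; apply.
  rewrite lee_fin powRM ?powR_ge0 ?invr_ge0//.
  rewrite -powRrM divff ?gt_eqF// powRr1 ?(ltW B0)// BE.
  rewrite -(powR_inv1 (ltW cn0)) -powRrM mulN1r /=.
  by rewrite -powRD// (gt_eqF cn0) implybT.
have [p1|p1] := leP p 1.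
  have le_B F g : normc (partial_fourier c f F g) <= B.
    exact: (partial_fourier_le g p0 p1 L0 (fL F)).
  case: q q0 pq => [q||]// q0 pq; last first.
    rewrite /= subr0 -BE unlock muT ifT ?lte_fin ?invr_gt0//.
    apply/ess_supP.
    have : \forall g \ae mu, normc (fh g) <= B.
      apply: (L2_limit_ae muT) => // e /approx[F FE].
      exists (partial_fourier c f F); split => //.
      exact: partial_fourier_bounded.
    apply: filterS => g gB /=.
    by rewrite ger0_norm ?lee_fin// normc_ge0.
  (* The pointwise bound controls all moments, so any exponent above both [q] and two may be
     taken. *)
  apply: (realq q (Num.max q 2)) => //.
  - by rewrite le_max lexx.
  - by rewrite le_max lexx orbT.
  move=> F; rewrite -[leRHS](mean_cst muT).
  have m0 : 0 <= Num.max q 2 by rewrite le_max ler0n orbT.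
  apply: le_mean => //.
  - apply: bounded_measurable_powR => //; first by move=> g; exact: normc_ge0.
    exact/bounded_measurable_normc/partial_fourier_bounded.
  - exact: bounded_measurable_cst.
  - by move=> g; rewrite ge0_ler_powR ?nnegrE ?normc_ge0 ?(ltW B0).
have p10 : 0 < p - 1 by rewrite subr_gt0.
have pV1 : p^-1 < 1 by rewrite invf_lt1.
case: q q0 pq => [q||]//= q0 pq; last by move: pq; rewrite addr0 leNgt pV1.
(* The conjugate exponent of [p]; the condition [1 / p + 1 / q >= 1] says that [q <= r]. *)
pose r := p / (p - 1).
have rp : r / (r - 1) = p by rewrite /r; field; rewrite gt_eqF//=; lra.
have r2 : 2 <= r by rewrite /r ler_pdivlMr//; lra.
apply: (realq q r) => //.
- rewrite -[q]invrK -[r]invrK lef_pV2 ?posrE ?invr_gt0//; last by lra.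
  have -> : r^-1 = 1 - p^-1 by rewrite /r; field; rewrite !gt_eqF.
  by lra.
- move=> F; apply: partial_fourier_hausdorff_young => //.
  by rewrite rp.
Qed.

End fourier_upper_bound.

(** * Test functions *)

Section character_sums.
Context {R : realType} {X : zmodType}.
Variables (c : {posnum R}) (mu : {measure set (dual R X) -> \bar R}).
Hypothesis haar : dual_haar c mu.
Implicit Types (s : seq X) (eps : X -> R[i]).
Local Notation mean := (mean mu c).
Local Notation cmean := (cmean mu c).
Let muT := dual_haarT haar.

Definition character_sum s eps (g : dual R X) : R[i] :=
  \sum_(x <- s) eps x * conjc (chr g x).

Lemma character_sum_bounded s eps : cbounded_measurable (character_sum s eps).
Proof.
apply: cbounded_measurable_sum => x.
apply: cbounded_measurableM; first exact: cbounded_measurable_cst.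
exact: conj_chr_bounded.
Qed.

Lemma normc_character_sum s eps g : (forall x, normc (eps x) = 1) ->
  normc (character_sum s eps g) <= (size s)%:R.
Proof.
move=> eps1; rewrite (le_trans (normc_sum _ _))//.
under eq_bigr do rewrite normcM normc_conj normc_chr eps1 mulr1.
by rewrite big_const_seq count_predT iter_addr addr0.
Qed.

Lemma cmean_character_sum s eps x : uniq s ->
  cmean (fun g => character_sum s eps g * chr g x) = if x \in s then eps x else 0.
Proof.
move=> us.
have B y : cbounded_measurable (fun g : dual R X => conjc (chr g y) * chr g x).
  by apply: cbounded_measurableM; [exact: conj_chr_bounded|exact: chr_bounded].
under eq_cmean => g do rewrite /character_sum mulr_suml.
rewrite cmean_sum//; last first.
  move=> y; under eq_fun => g do rewrite -mulrA.
  by apply: cbounded_measurableM; [exact: cbounded_measurable_cst|exact: B].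
rewrite (eq_bigr (fun y => eps y * (y == x)%:R)) => [|y _]; last first.
  under eq_cmean => g do rewrite -mulrA.
  rewrite cmeanZ//; congr (_ * _).
  rewrite -(cmean_chr_conj haar y x).
  by apply: eq_cmean => g; rewrite conjcK.
case: ifPn => xs.
  rewrite (bigD1_seq x)//= eqxx mulr1 big1 ?addr0// => y /negbTE ->.
  by rewrite mulr0.
rewrite big1_seq// => y /andP[_ ys]; have [yx|_] := eqVneq y x.
  by rewrite yx (negbTE xs) in ys.
by rewrite mulr0.
Qed.

Lemma mean_character_sum_sqr s eps : uniq s -> (forall x, normc (eps x) = 1) ->
  mean (fun g => normc (character_sum s eps g) ^+ 2) = (size s)%:R.
Proof.
move=> us eps1; rewrite mean_normc_sqr.
have SB := character_sum_bounded s eps.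
under eq_cmean => g.
  rewrite {2}/character_sum conjc_sum mulr_sumr.
  under eq_bigr do rewrite rmorphM /= conjcK mulrCA.
  over.
rewrite cmean_sum//; last first.
  move=> x; apply: cbounded_measurableM; first exact: cbounded_measurable_cst.
  by apply: cbounded_measurableM => //; exact: chr_bounded.
rewrite big_seq (eq_bigr (fun=> 1)) => [|x xs]; last first.
  rewrite cmeanZ//; last by apply: cbounded_measurableM => //; exact: chr_bounded.
  by rewrite cmean_character_sum// xs mulrC mul_conjc eps1 expr1n.
rewrite -big_seq Re_sum big_const_seq count_predT iter_addr addr0.
by [].
Qed.

Lemma powR_character_sum_bounded s eps r : 0 <= r ->
  bounded_measurable (fun g => normc (character_sum s eps g) `^ r).
Proof.
move=> r0; apply: bounded_measurable_powR => //.
- by move=> g; exact: normc_ge0.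
- exact/bounded_measurable_normc/character_sum_bounded.
Qed.

Lemma bounded_measurableX d (T : measurableType d) (h : T -> R) n :
  bounded_measurable h -> bounded_measurable (fun t => h t ^+ n).
Proof.
move=> hB; elim: n => [|n IH].
  by under eq_fun do rewrite expr0; exact: bounded_measurable_cst.
by under eq_fun do rewrite exprS; exact: bounded_measurableM.
Qed.

Lemma expr_character_sum_bounded s eps n :
  bounded_measurable (fun g => normc (character_sum s eps g) ^+ n).
Proof. exact/bounded_measurableX/bounded_measurable_normc/character_sum_bounded. Qed.

(* For random signs the fourth moment is at most [3 n ^ 2] on average; choosing
   the signs one at a time makes this an induction. *)
Lemma exists_signs s : uniq s -> exists2 eps : X -> R[i],
  (forall x, normc (eps x) = 1) &
  mean (fun g => normc (character_sum s eps g) ^+ 4) <= 3 * (size s)%:R ^+ 2.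
Proof.
elim: s => [_|x s IH /= /andP[xs us]].
  exists (fun=> 1) => [x|]; first by rewrite normc1.
  rewrite [leLHS](_ : _ = 0) ?mulr_ge0 ?sqr_ge0//.
  rewrite -[RHS](mean_cst muT); apply: eq_mean => g.
  by rewrite /character_sum big_nil normc0 expr0n.
have [eps eps1 hs] := IH us.
pose A := character_sum s eps.
pose e (z : R[i]) y := if y == x then z else eps y.
have sumE z g : character_sum (x :: s) (e z) g = z * conjc (chr g x) + A g.
  rewrite /character_sum big_cons /e eqxx; congr (_ + _).
  by apply: eq_big_seq => y ys; case: eqP ys xs => // -> ->.
have e1 z : normc z = 1 -> forall y, normc (e z y) = 1.
  by move=> z1 y; rewrite /e; case: ifP.
pose m z := mean (fun g => normc (character_sum (x :: s) (e z) g) ^+ 4).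
(* With [U = |A| ^ 2] and [w] the real part of the product of [chr g x] and [A g], the two fourth
   powers add up to [2 (1 + U) ^ 2 + 8 w ^ 2], and [w ^ 2 <= U]. *)
have le_m : m 1 + m (-1) <= 2 * mean (fun g => normc (A g) ^+ 4) +
    12 * (size s)%:R + 2.
  have AB n : bounded_measurable (fun g => normc (A g) ^+ n).
    exact: expr_character_sum_bounded.
  have rhsB : bounded_measurable (fun g => 2 * normc (A g) ^+ 4 + 12 * normc (A g) ^+ 2).
    by apply: bounded_measurableD; exact: bounded_measurableZ.
  have -> : 2 * mean (fun g => normc (A g) ^+ 4) + 12 * (size s)%:R + 2 =
      mean (fun g => 2 * normc (A g) ^+ 4 + 12 * normc (A g) ^+ 2 + 2).
    rewrite meanD//; last exact: bounded_measurable_cst.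
    rewrite meanD//; try exact: bounded_measurableZ.
    by rewrite !meanZ// mean_cst// mean_character_sum_sqr.
  rewrite -meanD//; try exact: expr_character_sum_bounded.
  apply: le_mean => //.
  - by apply: bounded_measurableD; exact: expr_character_sum_bounded.
  - by apply: bounded_measurableD => //; exact: bounded_measurable_cst.
  move=> g; rewrite !sumE !(exprM _ 2 2) !sqr_normcE.
  have := normc_chr g x; move=> /(congr1 (fun y => y ^+ 2)).
  rewrite sqr_normcE expr1n; case: (chr g x) (A g) => a b [a' b'] /= ab.
  set U := a' ^+ 2 + b' ^+ 2; pose w := a * a' - b * b'.
  have -> : (1 * a - 0 * - b + a') ^+ 2 + (1 * - b + 0 * a + b') ^+ 2 =
      1 + U + 2 * w.
    by transitivity (a ^+ 2 + b ^+ 2 + U + 2 * w); [rewrite /U /w; ring|rewrite ab].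
  have -> : (-1 * a - - 0 * - b + a') ^+ 2 + (-1 * - b + - 0 * a + b') ^+ 2 =
      1 + U - 2 * w.
    by transitivity (a ^+ 2 + b ^+ 2 + U - 2 * w); [rewrite /U /w; ring|rewrite ab].
  have wU : w ^+ 2 <= U.
    have -> : U = w ^+ 2 + (a * b' + b * a') ^+ 2.
      by rewrite -[LHS]mul1r -{1}ab /U /w; ring.
    by rewrite lerDl sqr_ge0.
  by clear -wU; lra.
(* The better sign does not exceed the average, and for [n = size s] that average is at most
   [3 n ^ 2 + 6 n + 1], below [3 (n + 1) ^ 2]. *)
have e_le z : normc z = 1 -> m z <= (m 1 + m (-1)) / 2 ->
    exists2 eps : X -> R[i], (forall x, normc (eps x) = 1) &
    mean (fun g => normc (character_sum (x :: s) eps g) ^+ 4) <=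
      3 * (size s).+1%:R ^+ 2.
  move=> z1 mz; exists (e z); first exact: e1.
  rewrite (le_trans mz)// ler_pdivrMr// (le_trans le_m)//.
  have : 0 <= (size s)%:R :> R by [].
  by rewrite -natr1; move: hs; nra.
have [m1|m1] := leP (m 1) (m (-1)).
  by apply: (e_le 1); rewrite ?normc1//; lra.
by apply: (e_le (-1)); rewrite ?normcN ?normc1//; lra.
Qed.

(** Cauchy-Schwarz for [|S| ^ 2] against the character sum [K] of [D]. As all differences lie in
    [D], the pairing counts every pair of elements of [s] once, while the mean of [|K| ^ 2] is the
    size of [D]. *)
Lemma mean_energy s D : uniq s -> uniq D ->
  (forall x y, x \in s -> y \in s -> x - y \in D) ->
  (size s)%:R ^+ 4 <=
    (size D)%:R * mean (fun g => normc (character_sum s (fun=> 1) g) ^+ 4).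
Proof.
move=> us uD sD; pose one := (fun _ : X => 1 : R[i]).
have one1 x : normc (one x) = 1 by rewrite normc1.
pose S := character_sum s one; pose K := character_sum D one.
have SB : cbounded_measurable S by exact: character_sum_bounded.
have KB : cbounded_measurable K by exact: character_sum_bounded.
have S2B : bounded_measurable (fun g => normc (S g) ^+ 2).
  exact: expr_character_sum_bounded.
have S4B : bounded_measurable (fun g => normc (S g) ^+ 4).
  exact: expr_character_sum_bounded.
have K2B : bounded_measurable (fun g => normc (K g) ^+ 2).
  exact: expr_character_sum_bounded.
have pairE : mean (fun g => complex.Re (S g * conjc (S g) * conjc (K g))) =
    (size s)%:R ^+ 2.
  rewrite -Re_cmean.
  have -> : (fun g => S g * conjc (S g) * conjc (K g)) =
      (fun g => \sum_(x <- s) \sum_(y <- s) conjc (K g * chr g (x - y))).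
    apply: funext => g; rewrite {1 2}/S /character_sum mulr_suml mulr_suml.
    apply: eq_bigr => x _; rewrite mul1r conjc_sum mulr_sumr mulr_suml.
    apply: eq_bigr => y _; rewrite mul1r conjcK chrB !rmorphM /= conjcK.
    by rewrite [RHS]mulrC.
  have KxB z : cbounded_measurable (fun g : dual R X => K g * chr g z).
    by apply: cbounded_measurableM => //; exact: chr_bounded.
  rewrite cmean_sum//; last first.
    by move=> x; apply: cbounded_measurable_sum => y; exact: cbounded_measurable_conj.
  rewrite big_seq (eq_bigr (fun=> (size s)%:R)) => [|x xs]; last first.
    rewrite cmean_sum//; last by move=> y; exact: cbounded_measurable_conj.
    rewrite big_seq (eq_bigr (fun=> 1)) => [|y ys]; last first.
      by rewrite cmean_conj// cmean_character_sum// sD// conjc1.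
    by rewrite -big_seq big_const_seq count_predT iter_addr addr0.
  rewrite -big_seq big_const_seq count_predT iter_addr addr0.
  by rewrite -mulrnA Re_nat natrM expr2.
have pairB : bounded_measurable (fun g => complex.Re (S g * conjc (S g) * conjc (K g))).
  apply: (cbounded_measurableM _ _).1; last exact: cbounded_measurable_conj.
  by apply: cbounded_measurableM => //; exact: cbounded_measurable_conj.
have [D0|D0] := posnP (size D).
  have [s0|s0] := posnP (size s); first by rewrite s0 D0 expr0n mul0r.
  have : nth 0 s 0 - nth 0 s 0 \in D by apply: sD; exact: mem_nth.
  by rewrite (size0nil D0).
have {}D0 : 0 < (size D)%:R :> R by rewrite ltr0n.
set N : R := (size s)%:R in pairE *; set M : R := (size D)%:R in D0 *.
(* The minimizer of the mean of the squared modulus of [|S| ^ 2 - t K], whose expansion is the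
   integrand below. *)
pose t := N ^+ 2 / M.
have : 0 <= mean (fun g => normc (S g) ^+ 4 +
    ((- 2 * t) * complex.Re (S g * conjc (S g) * conjc (K g)) +
     t ^+ 2 * normc (K g) ^+ 2)).
  apply: mean_ge0 => g.
  rewrite mul_conjc Re_realM (exprM _ 2 2).
  have -> : complex.Re (conjc (K g)) = complex.Re (K g) by case: (K g).
  rewrite (sqr_normcE (K g)).
  move: (normc (S g) ^+ 2) (complex.Re (K g)) (complex.Im (K g)) => a b b'.
  have := sqr_ge0 (a - t * b); have := sqr_ge0 (t * b').
  lra.
rewrite meanD//; last first.
  by apply: bounded_measurableD; exact: bounded_measurableZ.
rewrite meanD//; try exact: bounded_measurableZ.
rewrite !meanZ// pairE mean_character_sum_sqr// -/M.
move: (mean _) => m; rewrite /t => h.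
have -> : N ^+ 4 = M * (N ^+ 4 / M) by field; rewrite gt_eqF.
rewrite ler_pM2l//.
have -> : N ^+ 4 / M = 2 * (N ^+ 2 / M) * N ^+ 2 - (N ^+ 2 / M) ^+ 2 * M.
  by field; rewrite gt_eqF.
by move: h; lra.
Qed.

End character_sums.

(** * Large finite sets with few differences *)

Section small_doubling.
Context {X : zmodType}.
Implicit Types (F D H : {fset X}) (x : X).

Lemma infinite_notin H : infinite_set [set: X] -> exists x, x \notin H.
Proof.
move=> Xinf; apply: contrapT => /forallNP XH; apply: Xinf.
apply: (@sub_finite_set _ _ [set` H]); last exact: finite_fset.
by move=> x _; apply: contrapT => /negP; exact: XH.
Qed.

Definition diff_closed H := forall x y, x \in H -> y \in H -> x - y \in H.

Lemma mulrn_modn x n k : x *+ n = 0 -> x *+ (k %% n) = x *+ k.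
Proof.
by move=> xn; rewrite [in RHS](divn_eq k n) mulrnDr mulnC mulrnA xn mul0rn add0r.
Qed.

(** The sum of [H] and the finite cyclic group generated by [x]; it is larger because it contains
    [x]. *)
Lemma torsion_subgroup_extend H x n : (0 < n)%N -> x *+ n = 0 ->
  0 \in H -> diff_closed H -> x \notin H ->
  exists H', [/\ 0 \in H', diff_closed H' & (#|` H| < #|` H'|)%N].
Proof.
move=> n0 xn H0 HB xH.
pose H' := [fset (h + x *+ j)%R | h in H, j in iota 0 n]%fset.
have H'P y : reflect (exists h j, [/\ h \in H & y = h + x *+ j]) (y \in H').
  apply: (iffP idP) => [/imfset2P[h hH [j _ ->]]|[h [j [hH ->]]]].
    by exists h, j.
  apply/imfset2P; exists h => //; exists (j %% n)%N; last by rewrite mulrn_modn.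
  by rewrite /= mem_iota /= add0n ltn_pmod.
have HH' : (H `<=` H')%fset.
  by apply/fsubsetP => h hH; apply/H'P; exists h, 0%N; rewrite mulr0n addr0.
exists H'; split.
- exact: (fsubsetP HH').
- move=> y z /H'P[h [j [hH ->]]] /H'P[k [l [kH ->]]]; apply/H'P.
  (* The coefficient [n - l %% n] represents [- l] modulo [n] by a natural number. *)
  exists (h - k), (j + (n - l %% n))%N; split; first exact: HB.
  rewrite mulrnDr mulrnBr ?xn; last by rewrite ltnW// ltn_pmod.
  by rewrite mulrn_modn// sub0r opprD addrACA.
- apply: fproper_ltn_card; rewrite fproperE HH'; apply/negP => /fsubsetP H'H.
  move/negP: xH; apply; apply: H'H; apply/H'P.
  by exists 0, 1%N; rewrite add0r mulr1n.
Qed.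

Lemma exists_torsion_subgroup : infinite_set [set: X] ->
  (forall x, exists2 n, (0 < n)%N & x *+ n = 0) ->
  forall k, exists H, [/\ 0 \in H, diff_closed H & (k <= #|` H|)%N].
Proof.
move=> Xinf Xtors; elim=> [|k [H [H0 HB kH]]].
  exists [fset 0]%fset; split; rewrite ?inE//.
  by move=> x y; rewrite !inE => /eqP -> /eqP ->; rewrite subrr.
have [x xH] := infinite_notin H Xinf.
have [n n0 xn] := Xtors x.
have [H' [H'0 H'B HH']] := torsion_subgroup_extend n0 xn H0 HB xH.
by exists H'; split => //; exact: leq_ltn_trans HH'.
Qed.

(* Arithmetic progressions if [X] has an element of infinite order, finite
   subgroups otherwise. *)
Lemma exists_small_doubling : infinite_set [set: X] -> forall k,
  exists F D, [/\ (k < #|` F|)%N, (#|` D| <= 2 * #|` F|)%N &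
                  forall x y, x \in F -> y \in F -> x - y \in D].
Proof.
move=> Xinf k.
have [Xtors|] := pselect (forall x : X, exists2 n, (0 < n)%N & x *+ n = 0).
  have [H [_ HB kH]] := exists_torsion_subgroup Xinf Xtors k.+1.
  by exists H, H; split=> //; rewrite leq_pmull.
move=> /existsNP[x xinf].
have x_inj : injective (fun n => x *+ n).
  move=> m n; wlog mn : m n / (m <= n)%N.
    by move=> W; have [/W|/ltnW/W] := leqP m n => // + /esym => /[apply].
  move=> xmn; apply/eqP; rewrite eqn_leq mn /= leqNgt; apply/negP => ltmn.
  apply: xinf; exists (n - m)%N; first by rewrite subn_gt0.
  by rewrite mulrnBr// -xmn subrr.
pose F := [fset (x *+ i)%R | i in iota 0 k.+1]%fset.
(* Differences of indices run from [-k] to [k]; shifting by [k] makes them natural numbers from [0]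
   to [2 k], which the range of length [2 (k + 1)] covers. *)
pose D := [fset (x *+ i - x *+ k)%R | i in iota 0 (2 * k.+1)%N]%fset.
have size_iota_mem n : size (enum_finmem (mem_fin (fin_finpred (iota 0 n)))) = n.
  rewrite -[RHS](size_iota 0 n); apply/perm_size/uniq_perm => [||i].
  - exact: enum_finmem_uniq.
  - exact: iota_uniq.
  - by rewrite enum_finmemE.
have cF : #|` F| = k.+1.
  rewrite card_imfset; last exact: x_inj.
  exact: size_iota_mem.
exists F, D; split; rewrite ?cF//.
  by rewrite (leq_trans (leq_imfset_card _ _ _))// size_iota_mem.
move=> _ _ /imfsetP[i ik ->] /imfsetP[j jk ->].
have {}ik : (i <= k)%N by have : i \in iota 0 k.+1 := ik; rewrite mem_iota.
have {}jk : (j <= k)%N by have : j \in iota 0 k.+1 := jk; rewrite mem_iota.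
apply/imfsetP; exists (i + (k - j))%N.
  suff : (i + (k - j))%N \in iota 0 (2 * k.+1) by [].
  rewrite mem_iota /= add0n mul2n -addnn addnS ltnS addSn.
  by rewrite (leq_trans (leq_add ik (leq_subr j k)))// leqnSn.
by rewrite mulrnDr mulrnBr// addrA addrAC addrK.
Qed.

End small_doubling.

(** * Lower bounds from functions of constant modulus on a finite set *)

Section flat_functions.
Context {R : realType} {X : zmodType}.
Variables (c : {posnum R}) (mu : {measure set (dual R X) -> \bar R}).
Hypothesis haar : dual_haar c mu.
Implicit Types (F D : {fset X}) (eps : X -> R[i]) (p q : \bar R).
Local Notation haarX := (haar_discr X c).
Local Notation mean := (mean mu c).
Let muT := dual_haarT haar.

Definition flat F eps (a : R) (x : X) : R[i] :=
  if x \in F then (a%:C)%C * eps x else 0.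

Lemma normc_flat F eps a x : (forall x, normc (eps x) = 1) -> 0 <= a ->
  normc (flat F eps a x) = if x \in F then a else 0.
Proof.
move=> eps1 a0; rewrite /flat; case: ifP => _; last exact: normc0.
by rewrite normcM eps1 mulr1 normc_real ger0_norm.
Qed.

Lemma integral_flat F eps (a s : R) : (forall x, normc (eps x) = 1) -> 0 <= a ->
  s != 0 ->
  (\int[haarX]_x (normc (flat F eps a x) `^ s)%:E =
    (c%:num * #|` F|%:R * a `^ s)%:E)%E.
Proof.
move=> eps1 a0 s0.
rewrite (@eq_integral _ _ _ haarX _
    (fun x => ((a `^ s)%:E * (\1_[set` F] x)%:E)%E)) => [|x _]; last first.
  rewrite normc_flat// indicE; have [xF|xF] := boolP (x \in F).
    by rewrite mem_set// mule1.
  by rewrite memNset ?mule0 ?powR0//; exact/negP.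
rewrite ge0_integralZl_EFin ?powR_ge0//.
by rewrite integral_indic// setIT haar_discr_fset -EFinM mulrC.
Qed.

(** The support has mass [c |F|], which dictates the height. For [p = +oo] the exponent is zero and
    the height is one. *)
Lemma normX_flat F eps p : (forall x, normc (eps x) = 1) -> (0 < #|` F|)%N ->
  (0 < p)%E ->
  normX c p (flat F eps ((c%:num * #|` F|%:R) `^ (- recip p))) = 1%E.
Proof.
move=> eps1 F0 p0; set k : R := c%:num * #|` F|%:R.
have k0 : 0 < k by rewrite mulr_gt0// ltr0n.
case: p p0 => [p||]//= p0.
  rewrite /normX Lnorm_powR; last by move=> x; exact: normc_ge0.
  rewrite integral_flat ?powR_ge0//; last by rewrite gt_eqF.
  rewrite -powRrM mulNr mulVf; last by rewrite gt_eqF.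
  by rewrite powR_inv1 ?(ltW k0)// -/k divff ?gt_eqF// poweR1r.
rewrite oppr0 powRr0 /normX unlock.
have Fpos : (0 < haarX [set` F])%E by rewrite haar_discr_fset lte_fin.
have Tpos : (0 < haarX [set: discr X])%E.
  apply: (lt_le_trans Fpos); apply: le_measure.
  - by apply/mem_set.
  - by apply/mem_set.
  - exact: subsetT.
rewrite ifT//; apply/eqP; rewrite eq_le; apply/andP; split.
  apply/ess_supP; apply: aeW => x /=; rewrite normc_flat//.
  by case: ifP => _; rewrite ?normr1 ?normr0 lee_fin.
have [x xF] : exists x, x \in F by apply/fset0Pn; rewrite -cardfs_gt0.
have xpos : (0 < haarX [set` [fset x]%fset])%E.
  by rewrite haar_discr_fset cardfs1 mulr1 lte_fin.
(* A point of [F] has positive mass, so it cannot lie in the exceptional null set. *)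
have := ess_sup_ge haarX (abse \o (fun y : discr X => (normc (flat F eps 1 y))%:E)).
move=> [N [mN N0 subN]]; rewrite leNgt; apply/negP => sup1.
have xN : N x.
  apply: subN => /=; rewrite normc_flat// xF normr1 => /(lt_le_trans sup1).
  by rewrite ltxx.
move: xpos; rewrite -N0 ltNge => /negP; apply; apply: le_measure.
- by apply/mem_set.
- exact/mem_set.
- by rewrite set_fset1 => y ->.
Qed.

Lemma normX2_flat F eps a : (forall x, normc (eps x) = 1) -> 0 <= a ->
  (normX c 2%:E (flat F eps a) < +oo)%E.
Proof.
move=> eps1 a0; rewrite /normX Lnorm_powR; last by move=> x; exact: normc_ge0.
by rewrite integral_flat// poweR_lty// ltry.
Qed.

(** The partial transforms no longer change once the finite set contains the support. *)
Lemma is_fourier_flat F eps a :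
  is_fourier c mu (flat F eps a) (partial_fourier c (flat F eps a) F).
Proof.
have [[mRe _] [mIm _]] := partial_fourier_bounded c (flat F eps a) F.
split => //; split => // e e0; exists F => G FG.
rewrite (_ : (fun g => _) = cst 0%E) ?Lnorm0 ?lte_fin//.
apply: funext => g /=; rewrite /partial_fourier.
rewrite -(big_fset_incl _ FG) ?subrr ?normc0// => x xG xF.
by rewrite /flat (negbTE xF) mul0r.
Qed.

Lemma partial_fourier_flat F eps a g : 0 <= a ->
  normc (partial_fourier c (flat F eps a) F g) =
  c%:num * a * normc (character_sum F eps g).
Proof.
move=> a0; rewrite normcM normc_real ger0_norm// -mulrA; congr (_ * _).
rewrite -[a in RHS]ger0_norm// -normc_real -normcM /character_sum mulr_sumr.
by congr normc; apply: eq_big_seq => x xF; rewrite /flat xF mulrA.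
Qed.

Lemma Cpq_ge_flat F eps p q : (forall x, normc (eps x) = 1) -> (0 < #|` F|)%N ->
  (0 < p)%E ->
  (Lnorm mu q (fun g => (c%:num * (c%:num * #|` F|%:R) `^ (- recip p) *
     normc (character_sum F eps g))%:E) <= Cpq c mu p q)%E.
Proof.
move=> eps1 F0 p0; apply: ereal_sup_ubound.
set a := _ `^ _; have a0 : 0 <= a by exact: powR_ge0.
exists (flat F eps a), (partial_fourier c (flat F eps a) F); split.
- exact: normX2_flat.
- exact: normX_flat.
- exact: is_fourier_flat.
- by apply: eq_Lnorm => g; rewrite partial_fourier_flat.
Qed.

Lemma Lnorm_character_sum F eps (k A q : R) : 0 < q -> 0 <= k -> 0 <= A ->
  A <= mean (fun g => normc (character_sum F eps g) `^ q) ->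
  ((k * (A / c%:num) `^ q^-1)%:E <=
    Lnorm mu q%:E (fun g => (k * normc (character_sum F eps g))%:E))%E.
Proof.
move=> q0 k0 A0 Amean.
have -> : k * (A / c%:num) `^ q^-1 = (k `^ q * (A / c%:num)) `^ q^-1.
  rewrite [RHS]powRM ?powR_ge0 ?divr_ge0//.
  by rewrite -powRrM divff ?gt_eqF// powRr1.
apply: Lnorm_ge_powR => //.
- by move=> g; rewrite mulr_ge0 ?normc_ge0.
- by rewrite mulr_ge0 ?powR_ge0// divr_ge0.
have SB := powR_character_sum_bounded F eps (ltW q0).
rewrite (_ : (fun g => _) = fun g =>
  (k `^ q * normc (character_sum F eps g) `^ q)%:E); last first.
  by apply: funext => g; rewrite powRM ?normc_ge0.
rewrite (integral_mean muT); last exact: bounded_measurableZ.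
rewrite lee_fin meanZ// mulrA ler_pM2r ?invr_gt0//.
by rewrite ler_wpM2l ?powR_ge0.
Qed.

(** The transform of the normalized point mass at zero has constant modulus [c ^ (1 - 1 / p)], on a
    space of mass [1 / c]. *)
Lemma Cpq_ge_delta p q : (0 < p)%E -> (0 < q)%E ->
  ((c%:num `^ (1 - recip p - recip q))%:E <= Cpq c mu p q)%E.
Proof.
move=> p0 q0; have cn0 : 0 < c%:num by [].
pose Z : {fset X} := [fset 0%R]%fset.
have S1 (g : dual R X) : normc (character_sum Z (fun=> 1 : R[i]) g) = 1.
  rewrite /character_sum big_seq_fset1 normcM normc_conj normc_chr mulr1.
  exact: normc1.
have F0 : (0 < #|` Z|)%N by rewrite cardfs1.
apply: le_trans (Cpq_ge_flat q (fun=> normc1 R) F0 p0).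
rewrite cardfs1 mulr1; set k := c%:num * _.
have k0 : 0 < k by rewrite mulr_gt0// powR_gt0.
have kE : k = c%:num `^ (1 - recip p).
  by rewrite powRD ?(gt_eqF cn0) ?implybT// powRr1.
case: q q0 => [q||]//= q0.
  have := @Lnorm_character_sum Z (fun=> 1) k 1 q q0 (ltW k0) ler01.
  rewrite (_ : (fun g => _ `^ q) = fun=> 1); last first.
    by apply: funext => g; rewrite S1 powR1.
  rewrite (mean_cst muT) => /(_ (lexx _)); apply: le_trans.
  rewrite lee_fin kE div1r -(powR_inv1 (ltW cn0)) -powRrM mulN1r.
  by rewrite -powRD// (gt_eqF cn0) implybT.
rewrite subr0 -kE unlock muT ifT ?lte_fin ?invr_gt0//.
apply: ess_sup_gee; first by rewrite muT lte_fin invr_gt0.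
by apply: nearW => g /=; rewrite S1 mulr1 lee_fin ler_norm.
Qed.

(** For [v = |S| / l] one has [v ^ 2 <= v ^ 4 + v ^ q]. The factor two in [l] makes the mean of
    [v ^ 2] equal to [1 / 4] and that of [v ^ 4] at most [3 / 16], which leaves [1 / 16] for
    [v ^ q]. *)
Lemma mean_powR_ge_signs (s : seq X) eps (q : R) : uniq s -> (0 < size s)%N ->
  (forall x, normc (eps x) = 1) -> 0 < q -> q <= 2 ->
  mean (fun g => normc (character_sum s eps g) ^+ 4) <= 3 * (size s)%:R ^+ 2 ->
  (2 * Num.sqrt (size s)%:R) `^ q / 16 <=
    mean (fun g => normc (character_sum s eps g) `^ q).
Proof.
move=> us s0 eps1 q0 q2 m4; set N : R := (size s)%:R in m4 *.
have N0 : 0 < N by rewrite ltr0n.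
set l := 2 * Num.sqrt N; have l0 : 0 < l by rewrite mulr_gt0// sqrtr_gt0.
have l2 : l ^+ 2 = 4 * N by rewrite exprMn sqr_sqrtr ?(ltW N0)//; ring.
pose u (g : dual R X) := normc (character_sum s eps g).
have uqB : bounded_measurable (fun g => u g `^ q).
  exact/powR_character_sum_bounded/ltW.
have u2B : bounded_measurable (fun g => u g ^+ 2) by exact: expr_character_sum_bounded.
have u4B : bounded_measurable (fun g => u g ^+ 4) by exact: expr_character_sum_bounded.
rewrite mulrC -ler_pdivlMr ?powR_gt0//.
have : mean (fun g => (4 * N)^-1 * u g ^+ 2) <=
    mean (fun g => (16 * N ^+ 2)^-1 * u g ^+ 4 + (l `^ q)^-1 * u g `^ q).
  apply: (le_mean muT); try exact: bounded_measurableZ.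
    by apply: bounded_measurableD; exact: bounded_measurableZ.
  move=> g; pose v := u g / l.
  have u0 : 0 <= u g by exact: normc_ge0.
  have v0 : 0 <= v by rewrite divr_ge0// ltW.
  have -> : (l `^ q)^-1 * u g `^ q = v `^ q.
    by rewrite [RHS]powRM ?invr_ge0 ?(ltW l0)// powRV ?(ltW l0)// mulrC.
  have -> : (4 * N)^-1 * u g ^+ 2 = v ^+ 2 by rewrite exprMn exprVn l2 mulrC.
  have -> : (16 * N ^+ 2)^-1 * u g ^+ 4 = v ^+ 4.
    rewrite exprMn exprVn mulrC; congr (_ / _).
    by rewrite (exprM l 2 2) l2; ring.
  (* Above one the fourth power dominates the square; below one the [q]-th power does, as
     [q <= 2]. *)
  have [v1|v1] := leP v 1; last first.
    rewrite ler_wpDr ?powR_ge0// (exprM v 2 2) [leRHS]expr2 ler_peMr ?sqr_ge0//.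
    by rewrite exprn_ege1// ltW.
  rewrite ler_wpDl ?exprn_ge0//.
  have [->|vn0] := eqVneq v 0; first by rewrite expr0n /= powR_ge0.
  rewrite -powR_mulrn// ger_powR// v1 andbT.
  by rewrite lt_neqAle eq_sym vn0.
rewrite meanD//; try exact: bounded_measurableZ.
rewrite !meanZ//.
rewrite mean_character_sum_sqr// -/N.
have : (16 * N ^+ 2)^-1 * mean (fun g => u g ^+ 4) <= 3 / 16.
  rewrite ler_pdivrMl ?mulr_gt0 ?exprn_gt0//.
  by apply: le_trans m4 _; rewrite le_eqVlt; apply/orP; left; apply/eqP; field.
have -> : (4 * N)^-1 * N = 4^-1 by field; rewrite gt_eqF.
rewrite [leRHS in _ -> _ -> _ <= leRHS]mulrC.
by lra.
Qed.

Lemma mean_pow4_ge F D : (0 < #|` F|)%N -> (#|` D| <= 2 * #|` F|)%N ->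
  (forall x y, x \in F -> y \in F -> x - y \in D) ->
  #|` F|%:R ^+ 3 / 2 <= mean (fun g => normc (character_sum F (fun=> 1) g) ^+ 4).
Proof.
move=> F0 DF FD; have := mean_energy haar (fset_uniq F) (fset_uniq D) FD.
set m := mean _; set N : R := #|` F|%:R => le_m.
have N0 : 0 < N by rewrite ltr0n.
have m0 : 0 <= m by apply: mean_ge0 => g; rewrite exprn_ge0 ?normc_ge0.
have : N ^+ 4 <= 2 * N * m.
  apply: le_trans le_m _; rewrite ler_wpM2r// -natrM ler_nat.
  exact: DF.
have -> : N ^+ 4 = 2 * N * (N ^+ 3 / 2) by field.
by rewrite ler_pM2l// mulr_gt0.
Qed.

(** Where [|S| <= l = N / 2], the fourth power is at most [N ^ 2 / 4] times the square, which
    accounts for at most [N ^ 3 / 4] of the fourth moment, half of its lower bound. Elsewhere the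
    fourth power is at most [N ^ 4 (|S| / l) ^ q], and this part must supply the rest. *)
Lemma mean_powR_ge_doubling F D (q : R) : (0 < #|` F|)%N ->
  (#|` D| <= 2 * #|` F|)%N -> (forall x y, x \in F -> y \in F -> x - y \in D) ->
  0 < q ->
  (#|` F|%:R / 2) `^ q / (4 * #|` F|%:R) <=
    mean (fun g => normc (character_sum F (fun=> 1) g) `^ q).
Proof.
move=> F0 DF FD q0; have := mean_pow4_ge F0 DF FD.
set N : R := #|` F|%:R; have N0 : 0 < N by rewrite ltr0n.
have one1 (x : X) : normc (1 : R[i]) = 1 by exact: normc1.
pose u (g : dual R X) := normc (character_sum F (fun=> 1) g).
have uqB : bounded_measurable (fun g => u g `^ q).
  exact/powR_character_sum_bounded/ltW.
have u2B : bounded_measurable (fun g => u g ^+ 2) by exact: expr_character_sum_bounded.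
have u4B : bounded_measurable (fun g => u g ^+ 4) by exact: expr_character_sum_bounded.
set l := N / 2; have l0 : 0 < l by rewrite divr_gt0.
have : mean (fun g => u g ^+ 4) <=
    mean (fun g => N ^+ 2 / 4 * u g ^+ 2 + N ^+ 4 * (l `^ q)^-1 * u g `^ q).
  apply: le_mean => //.
    by apply: bounded_measurableD; exact: bounded_measurableZ.
  move=> g; have u0 : 0 <= u g by exact: normc_ge0.
  have uN : u g <= N by exact: (normc_character_sum F g one1).
  have [ul|ul] := leP (u g) l.
    rewrite ler_wpDr ?mulr_ge0 ?invr_ge0 ?powR_ge0 ?exprn_ge0 ?(ltW N0)//.
    rewrite (exprM _ 2 2) expr2 ler_wpM2r ?sqr_ge0//.
    have -> : N ^+ 2 / 4 = l ^+ 2 by rewrite /l; field.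
    by rewrite ler_pXn2r ?nnegrE ?(ltW l0).
  rewrite ler_wpDl ?mulr_ge0 ?sqr_ge0//.
  apply: (@le_trans _ _ (N ^+ 4)); first by rewrite ler_pXn2r ?nnegrE ?(ltW N0).
  rewrite -mulrA ler_peMr ?exprn_ge0 ?(ltW N0)//.
  rewrite ler_pdivlMl ?powR_gt0// mulr1.
  by rewrite ge0_ler_powR ?nnegrE ?(ltW l0) ?(ltW q0) ?(ltW ul).
rewrite meanD//; try exact: bounded_measurableZ.
rewrite !meanZ// mean_character_sum_sqr//; last exact: fset_uniq.
rewrite -/N -/(u _); move: (mean _) (mean _) => mq m4 h1 h2.
rewrite mulrC -ler_pdivlMr ?powR_gt0//.
have h : N ^+ 3 / 4 <= N ^+ 4 * (l `^ q)^-1 * mq.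
  have -> : N ^+ 3 / 4 = N ^+ 3 / 2 - N ^+ 2 / 4 * N by field.
  by clear -h1 h2; lra.
have : N ^+ 4 * (4 * N)^-1 <= N ^+ 4 * (mq / l `^ q).
  have -> : N ^+ 4 * (4 * N)^-1 = N ^+ 3 / 4 by field; rewrite gt_eqF.
  by rewrite [leRHS](_ : _ = N ^+ 4 * (l `^ q)^-1 * mq); [|ring].
by rewrite ler_pM2l// exprn_gt0.
Qed.

(** If [|S|] were at most [N / 2] almost everywhere, the fourth moment would be at most [N ^ 3 / 4],
    below its lower bound [N ^ 3 / 2]. *)
Lemma ess_sup_ge_doubling F D (k : R) : (0 < #|` F|)%N ->
  (#|` D| <= 2 * #|` F|)%N -> (forall x y, x \in F -> y \in F -> x - y \in D) ->
  0 < k ->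
  ((k * (#|` F|%:R / 2))%:E <=
    Lnorm mu +oo (fun g => (k * normc (character_sum F (fun=> 1) g))%:E))%E.
Proof.
move=> F0 DF FD k0; have := mean_pow4_ge F0 DF FD.
set N : R := #|` F|%:R; have N0 : 0 < N by rewrite ltr0n.
have one1 (x : X) : normc (1 : R[i]) = 1 by exact: normc1.
pose u (g : dual R X) := normc (character_sum F (fun=> 1) g).
have u2B : bounded_measurable (fun g => u g ^+ 2) by exact: expr_character_sum_bounded.
have u4B : bounded_measurable (fun g => u g ^+ 4) by exact: expr_character_sum_bounded.
move=> m4; rewrite unlock muT ifT ?lte_fin ?invr_gt0//.
rewrite leNgt; apply/negP => sup_lt.
have ae_u : \forall g \ae mu, u g <= N / 2.
  have := ess_sup_ge mu (abse \o (fun g => (k * u g)%:E)).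
  apply: filterS => g /= /le_lt_trans /(_ sup_lt).
  rewrite lte_fin ger0_norm ?mulr_ge0 ?normc_ge0 ?(ltW k0)//.
  by rewrite ltr_pM2l// => /ltW.
have : (\int[mu]_g (u g ^+ 4)%:E <= \int[mu]_g (N ^+ 2 / 4 * u g ^+ 2)%:E)%E.
  apply: ae_ge0_le_integral => //.
  - by move=> g _; rewrite lee_fin exprn_ge0 ?normc_ge0.
  - by apply/measurable_EFinP; case: u4B.
  - by move=> g _; rewrite lee_fin mulr_ge0 ?divr_ge0 ?sqr_ge0.
  - by apply/measurable_EFinP; case: (bounded_measurableZ (N ^+ 2 / 4) u2B).
  apply: filterS ae_u => g ul _; rewrite lee_fin.
  rewrite (exprM _ 2 2) expr2 ler_wpM2r ?sqr_ge0//.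
  have -> : N ^+ 2 / 4 = (N / 2) ^+ 2 by field.
  by rewrite ler_pXn2r ?nnegrE ?divr_ge0 ?(ltW N0) ?normc_ge0.
rewrite !(integral_mean muT)//; last exact: bounded_measurableZ.
rewrite lee_fin ler_pM2r ?invr_gt0// meanZ//.
rewrite mean_character_sum_sqr//; last exact: fset_uniq.
rewrite -/N => /(le_trans m4).
have -> : N ^+ 2 / 4 * N = N ^+ 3 / 4 by field.
by have := exprn_gt0 3 N0; clear one1; lra.
Qed.

Lemma unbounded_eq_pinfty (C : \bar R) (k s : R) : 0 < k -> 0 < s ->
  (forall m : nat, exists2 n : nat, (m < n)%N & ((k * n%:R `^ s)%:E <= C)%E) ->
  C = +oo%E.
Proof.
move=> k0 s0 kC; apply/eqyP => A A0.
pose B := (A / k) `^ s^-1.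
have [n Bn nC] := kC (Num.truncn B).
apply: le_trans nC; rewrite lee_fin mulrC -ler_pdivrMr//.
have -> : A / k = B `^ s.
  by rewrite /B -powRrM mulVf ?gt_eqF// powRr1// divr_ge0 ?(ltW A0) ?(ltW k0).
rewrite ge0_ler_powR ?nnegrE ?powR_ge0 ?(ltW s0)//.
by rewrite (le_trans (ltW (truncnS_gt _)))// ler_nat.
Qed.

Lemma Cpq_pinfty_doubling p q : infinite_set [set: X] -> (0 < p)%E -> (0 < q)%E ->
  recip p + recip q < 1 -> Cpq c mu p q = +oo%E.
Proof.
move=> Xinf p0 q0 pq; have cn0 : 0 < c%:num by [].
(* The factors of the lower bound that do not depend on [N]. The remaining ones are [N ^ (- 1 / p)]
   from the height, [N] from the size of the sum, and [N ^ (- 1 / q)] from the measure of the set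
   where it is large. *)
pose k := c%:num / 2 * c%:num `^ (- recip p) * (4 * c%:num) `^ (- recip q).
apply: (@unbounded_eq_pinfty _ k (1 - recip p - recip q)); last 1 first.
- move=> m; have [F [D [mF DF FD]]] := exists_small_doubling Xinf m.
  exists #|` F| => //.
  have F0 : (0 < #|` F|)%N by exact: leq_ltn_trans mF.
  apply: le_trans (Cpq_ge_flat q (fun=> normc1 R) F0 p0).
  set N : R := #|` F|%:R; have N0 : 0 < N by rewrite ltr0n.
  set a := c%:num * _ `^ _; have a0 : 0 < a by rewrite mulr_gt0// powR_gt0 ?mulr_gt0.
  have -> : k * N `^ (1 - recip p - recip q) =
      a * (N / 2) * (4 * c%:num * N) `^ (- recip q).
    rewrite powRD; last by rewrite (gt_eqF N0) implybT.
    rewrite powRD; last by rewrite (gt_eqF N0) implybT.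
    rewrite powRr1 ?(ltW N0)// /k /a !powRM ?mulr_ge0 ?(ltW N0)//.
    by ring.
  case: q q0 pq @k => [q||]//= q0 pq.
    have qF := mean_powR_ge_doubling F0 DF FD q0.
    have A0 : 0 <= (N / 2) `^ q / (4 * N) by rewrite divr_ge0 ?powR_ge0 ?mulr_ge0 ?(ltW N0).
    apply: le_trans (Lnorm_character_sum q0 (ltW a0) A0 qF).
    rewrite lee_fin -!mulrA ler_pM2l//.
    rewrite powRM ?powR_ge0 ?mulr_ge0 ?invr_ge0 ?(ltW N0)//.
    rewrite -powRrM divff ?gt_eqF// powRr1 ?divr_ge0 ?(ltW N0)// -mulrA.
    rewrite -invfM -(powR_inv1 (_ : 0 <= 4 * N * c%:num)) ?mulr_ge0 ?(ltW N0)//.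
    rewrite -powRrM mulN1r; have -> : 4 * (c%:num * N) = 4 * N * c%:num by ring.
    - exact: lexx.
    - by rewrite mulr_ge0// ltW.
  rewrite oppr0 powRr0 mulr1.
  exact: (ess_sup_ge_doubling F0 DF FD a0).
- by rewrite !mulr_gt0// ?powR_gt0// ?mulr_gt0.
- by lra.
Qed.

Lemma Cpq_pinfty_signs p (q : R) : infinite_set [set: X] -> (0 < p)%E -> 0 < q ->
  recip p < 2^-1 -> q <= 2 -> Cpq c mu p q%:E = +oo%E.
Proof.
move=> Xinf p0 q0 p2 q2; have cn0 : 0 < c%:num by [].
(* Again the factors free of [N]; here the sum has typical size [N ^ (1 / 2)] on a set of measure
   bounded below. *)
pose k := 2 * c%:num * c%:num `^ (- recip p) * (16 * c%:num) `^ (- q^-1).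
apply: (@unbounded_eq_pinfty _ k (2^-1 - recip p)); last 1 first.
- move=> m; have [F [_ [mF _ _]]] := exists_small_doubling Xinf m.
  exists #|` F| => //.
  have F0 : (0 < #|` F|)%N by exact: leq_ltn_trans mF.
  have [eps eps1 m4] := exists_signs haar (fset_uniq F).
  apply: le_trans (Cpq_ge_flat q%:E eps1 F0 p0).
  have qF := mean_powR_ge_signs (fset_uniq F) F0 eps1 q0 q2 m4.
  move: qF; rewrite -/(#|` F|); set N : R := #|` F|%:R => qF.
  have N0 : 0 < N by rewrite ltr0n.
  set a := c%:num * _ `^ _; have a0 : 0 < a by rewrite mulr_gt0// powR_gt0 ?mulr_gt0.
  have A0 : 0 <= (2 * Num.sqrt N) `^ q / 16 by rewrite divr_ge0 ?powR_ge0.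
  apply: le_trans (Lnorm_character_sum q0 (ltW a0) A0 qF).
  have l0 : 0 <= 2 * Num.sqrt N by rewrite mulr_ge0 ?sqrtr_ge0.
  have -> : k * N `^ (2^-1 - recip p) =
      a * (2 * Num.sqrt N) * (16 * c%:num) `^ (- q^-1).
    rewrite powRD; last by rewrite (gt_eqF N0) implybT.
    rewrite powR12_sqrt ?(ltW N0)// /k /a !powRM ?(ltW N0)//.
    by ring.
  rewrite lee_fin -mulrA ler_pM2l//.
  rewrite -mulrA powRM ?powR_ge0 ?mulr_ge0 ?invr_ge0//.
  rewrite -powRrM divff ?gt_eqF// powRr1//.
  rewrite -invfM -(powR_inv1 (_ : 0 <= 16 * c%:num)) ?mulr_ge0//.
  by rewrite -powRrM mulN1r.
- by rewrite !mulr_gt0// ?powR_gt0// ?mulr_gt0.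
- by lra.
Qed.

End flat_functions.

Theorem theorem4p1 (R : realType) (X : zmodType) (c : {posnum R})
  (mu : {measure set (dual R X) -> \bar R}) (p q : \bar R) :
  infinite_set [set: X] ->
  dual_haar c mu ->
  (0 < p)%E -> (0 < q)%E ->
  (* (1/p, 1/q) in R1' \/ R3'  ==>  C_{p,q} = +oo *)
  (( (recip p + recip q < 1 /\ recip q < 2^-1)
   \/ (recip p <= 1 /\ recip q <= 1 /\ recip p < 2^-1 /\ 2^-1 <= recip q) ) ->
     Cpq c mu p q = +oo%E)
  /\
  (* (1/p, 1/q) in R2'  ==>  C_{p,q} = \hat alpha(\hat X)^(1/p + 1/q - 1) *)
  ((1 <= recip p + recip q /\ 2^-1 <= recip p) ->
     Cpq c mu p q = ((mu [set: dual R X]) `^ (recip p + recip q - 1))%E).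
Proof.
move=> Xinf haar p0 q0; split.
  move=> [[pq _]|[_ [_ [p2 q2]]]]; first exact: Cpq_pinfty_doubling.
  (* An infinite [q] has reciprocal zero and is excluded by [1 / q >= 1 / 2]. *)
  case: q q0 q2 => [q||]//= q0 q2; last by move: q2; rewrite leNgt invr_gt0 ltr0n.
  apply: Cpq_pinfty_signs => //.
  by rewrite -[q]invrK -[leRHS]invrK lef_pV2 ?posrE ?invr_gt0.
move=> [pq p2]; rewrite (dual_haarT haar) poweR_EFin.
have cn0 : 0 < c%:num by [].
(* The total mass [1 / c] turns the claimed value into [c ^ (1 - 1 / p - 1 / q)], the constant of
   both the upper and the lower bound. *)
rewrite -(powR_inv1 (ltW cn0)) -powRrM mulN1r.
have -> : - (recip p + recip q - 1) = 1 - recip p - recip q by ring.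
apply/eqP; rewrite eq_le Cpq_ge_delta// andbT.
case: p p0 p2 pq => [p||]//= p0 p2 pq; last by move: p2; rewrite leNgt invr_gt0 ltr0n.
apply: ge_ereal_sup => _ [f [fh [_ f1 ffh ->]]].
apply: (fourier_upper_bound haar p0 _ q0 pq f1 ffh).
by rewrite -[p]invrK -[leRHS]invrK lef_pV2 ?posrE ?invr_gt0.
Qed.
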